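(* Let $\mathscr{A}$ be a $C^*$-algebra and let $v,w$ be positive functionals on $\mathscr{A}$. If $v$ is pure, then the following statements are equivalent: (i) $w$ is $v$-absolutely continuous; (ii) $w=\alpha v$ for some $\alpha\geq0$.
   Context: $w$ is absolutely continuous with respect to $v$ ($v$-absolutely continuous) if for every sequence $(a_n)$ in $\mathscr{A}$, $v(a_n^*a_n)\to0$ and $w((a_n^*-a_m^* )(a_n-a_m))\to0$ (as $n,m\to\infty$) imply $w(a_n^*a_n)\to0$. ''Pure'' has its standard meaning for positive functionals on a $C^*$-algebra. *)

(* Defs.v *)
From HB Require Import structures.
From mathcomp Require Import all_boot all_order all_algebra.
From mathcomp Require Import complex.
From mathcomp Require Import boolp classical_sets functions reals.
From mathcomp Require Import topology normedtype sequences.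

Set Implicit Arguments.
Unset Strict Implicit.
Unset Printing Implicit Defensive.

Import Order.TTheory GRing.Theory Num.Theory.
Import numFieldNormedType.Exports.

Local Open Scope classical_set_scope.
Local Open Scope ring_scope.
Local Open Scope complex_scope.

Reserved Notation "x ** y" (at level 40, left associativity).

(* Complex C*-algebras, not assumed to have a unit: the ring structures of
   the library are unital, so the product is part of the mixin. The norm of a
   normed module over [R[i]] takes values in [R[i]], where [x <= y] means that
   [y - x] is a nonnegative real. *)
HB.mixin Record CompleteNormedModule_isCStarAlgebra (R : realType) A
    of CompleteNormedModule R[i] A := {
  cstar_mul : A -> A -> A ;
  star : A -> A ;
  cstar_mulA : associative cstar_mul ;
  cstar_mulDl : left_distributive cstar_mul +%R ;
  cstar_mulDr : right_distributive cstar_mul +%R ;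
  cstar_mulZl : forall (c : R[i]) (a b : A),
    cstar_mul (c *: a) b = c *: cstar_mul a b ;
  cstar_mulZr : forall (c : R[i]) (a b : A),
    cstar_mul a (c *: b) = c *: cstar_mul a b ;
  starK : involutive star ;
  starD : {morph star : a b / a + b} ;
  starZ : forall (c : R[i]) (a : A), star (c *: a) = c^* *: star a ;
  starM : forall a b : A, star (cstar_mul a b) = cstar_mul (star b) (star a) ;
  cstar_normM : forall a b : A, `|cstar_mul a b| <= `|a| * `|b| ;
  cstar_norm_starM : forall a : A, `|cstar_mul (star a) a| = `|a| ^+ 2
}.

#[short(type="cstarAlgType")]
HB.structure Definition CStarAlgebra (R : realType) :=
  { A of CompleteNormedModule_isCStarAlgebra R A & CompleteNormedModule R[i] A }.

Declare Scope cstar_scope.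
Notation "x ** y" := (cstar_mul x y) : cstar_scope.
Local Open Scope cstar_scope.

(* In [R[i]], [0 <= z] includes that [z] is real. *)
Definition positive_functional (R : realType) (A : cstarAlgType R)
    (v : {scalar A}) : Prop :=
  forall a : A, 0 <= v (star a ** a).

Definition functional_le (R : realType) (A : cstarAlgType R)
    (u v : {scalar A}) : Prop :=
  forall a : A, u (star a ** a) <= v (star a ** a).

Definition pure_functional (R : realType) (A : cstarAlgType R)
    (v : {scalar A}) : Prop :=
  [/\ positive_functional v, (exists a : A, v a != 0) &
      forall u : {scalar A}, positive_functional u -> functional_le u v ->
        exists2 t : R, 0 <= t <= 1 & forall a : A, u a = t%:C * v a].

Definition absolutely_continuous (R : realType) (A : cstarAlgType R)
    (w v : {scalar A}) : Prop :=
  forall a : nat -> A,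
    v (star (a n) ** a n) @[n --> \oo] --> (0 : R[i]^o) ->
    w ((star (a p.1) - star (a p.2)) ** (a p.1 - a p.2)) @[p --> (\oo, \oo)]
      --> (0 : R[i]^o) ->
    w (star (a n) ** a n) @[n --> \oo] --> (0 : R[i]^o).

(* Main.v *)
(** Positive functionals on a C*-algebra without unit satisfy
    [|v a|^2 <= C v(a* a)]: they are bounded on squares of self-adjoint
    elements, and every [a] factors as [g b] with [g = |a a*|^(1/4)]
    approximately fixed by self-adjoint elements of norm at most [2].

    Put [s = v + w] and let [T] be the positive contraction representing the
    form of [v] in the completion of [A] for the form of [s]; it commutes with
    left multiplications. The form of [T^2] comes from a positive functional
    [u <= v], so purity of [v] gives [T^2 = t T] with [t <> 0]. Absolute
    continuity of [w] makes [T] injective: it is applied to a sequence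
    converging to [T a - t a], which [T] kills. Hence [T = t], that is,
    [v = t (v + w)]. Neither the completion nor [T] is constructed: [T a] is
    represented by the sequence [a ** e n], where [e] is a minimizing sequence
    for the Riesz representation of [v] with respect to [s]. *)
From HB Require Import structures.
Require Import Defs.
From mathcomp Require Import all_boot all_order all_algebra complex reals.
From mathcomp Require Import boolp classical_sets topology normedtype sequences.
From mathcomp Require Import ring lra.
Import Order.TTheory GRing.Theory Num.Theory Normc.
Import numFieldNormedType.Exports.
Set Implicit Arguments.
Unset Strict Implicit.
Unset Printing Implicit Defensive.

Local Open Scope classical_set_scope.
Local Open Scope ring_scope.
Local Open Scope complex_scope.
Local Open Scope cstar_scope.

(** * Elementary inequalities and limits of complex sequences *)

Lemma quad_discr (R : realFieldType) (n p q : R) : 0 <= p -> 0 <= n -> 0 <= q ->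
  (forall t, 0 <= p - 2 * t * n + t ^+ 2 * n * q) -> n <= q * p.
Proof.
move=> p0 n0 q0 h; move: q0; rewrite le_eqVlt => /orP[/eqP y0|y0]; last first.
  (* The quadratic in [t] is least at [1 / q], with value [p - n / q]. *)
  have := h q^-1.
  rewrite [X in 0 <= X](_ : _ = p - n / q); last by field; rewrite gt_eqF.
  by rewrite subr_ge0 ler_pdivrMr // mulrC.
(* For [q = 0] the expression is affine in [t]; at [(p + 1) / n] it equals [- p - 2 < 0]. *)
rewrite -y0 mul0r leNgt; apply/negP => np; have := h ((p + 1) / n).
rewrite -y0 mulr0 addr0 -mulrA divfK ?gt_eqF //.
by lra.
Qed.

Lemma sqrD_le (R : realDomainType) (p q r s : R) :
  p ^+ 2 <= r -> q ^+ 2 <= s -> (p + q) ^+ 2 <= 2 * r + 2 * s.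
Proof. by move=> pr qs; have := sqr_ge0 (p - q); nra. Qed.

Section ComplexModulus.
Variable R : realType.
Implicit Types (z : R[i]) (f : nat -> R[i]).

Lemma normc_ge0 z : 0 <= normc z.
Proof. by case: z => a b; apply: sqrtr_ge0. Qed.

Lemma normc_conj z : normc z^* = normc z.
Proof. by case: z => a b /=; rewrite sqrrN. Qed.

Lemma normc_real (r : R) : normc r%:C = `|r|.
Proof. by rewrite /normc /= expr0n addr0 sqrtr_sqr. Qed.

Lemma normc_sqr z : normc z ^+ 2 = complex.Re z ^+ 2 + complex.Im z ^+ 2.
Proof. by case: z => a b; rewrite sqr_sqrtr ?addr_ge0 ?sqr_ge0. Qed.

Lemma normcD z1 z2 : normc (z1 + z2) <= normc z1 + normc z2.
Proof. exact: le_normcD. Qed.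

Lemma normcB z1 z2 : normc (z1 - z2) = normc (z2 - z1).
Proof. by rewrite -normcN opprB. Qed.

Lemma ReD z1 z2 : complex.Re (z1 + z2) = complex.Re z1 + complex.Re z2.
Proof. by case: z1; case: z2. Qed.

Lemma ImD z1 z2 : complex.Im (z1 + z2) = complex.Im z1 + complex.Im z2.
Proof. by case: z1; case: z2. Qed.

Lemma ReN z : complex.Re (- z) = - complex.Re z.
Proof. by case: z. Qed.

Lemma ImN z : complex.Im (- z) = - complex.Im z.
Proof. by case: z. Qed.

Lemma Re_le_normc z : `|complex.Re z| <= normc z.
Proof.
rewrite -(ler_pXn2r (n := 2)) ?nnegrE ?normc_ge0 //.
by rewrite normc_sqr real_normK ?num_real // lerDl sqr_ge0.
Qed.

Lemma Im_le_normc z : `|complex.Im z| <= normc z.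
Proof.
rewrite -(ler_pXn2r (n := 2)) ?nnegrE ?normc_ge0 //.
by rewrite normc_sqr real_normK ?num_real // lerDr sqr_ge0.
Qed.

Lemma normc_le_ReIm z : normc z <= `|complex.Re z| + `|complex.Im z|.
Proof.
rewrite -(ler_pXn2r (n := 2)) ?nnegrE ?normc_ge0 ?addr_ge0 //.
rewrite normc_sqr sqrrD !real_normK ?num_real // lerD2r lerDl.
by rewrite mulrn_wge0 // mulr_ge0.
Qed.

Lemma ge0_complexE z : 0 <= z -> z = (complex.Re z)%:C.
Proof. by move=> z0; rewrite RRe_real // ger0_real. Qed.

Lemma harmonic_small (K e : R) : 0 < e -> exists m : nat, K / m.+1%:R < e.
Proof.
move=> e0; have K1 : 0 < `|K| + 1 by rewrite ltr_wpDl.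
have [|m] := @ltr_add_invr R 0 (e / (`|K| + 1)); first by rewrite divr_gt0.
rewrite add0r ltr_pdivlMr // => h; exists m.
apply: le_lt_trans h; rewrite mulrC ler_wpM2l ?invr_ge0 ?ler0n //.
by apply: le_trans (ler_norm _) _; rewrite lerDl.
Qed.

Lemma le_harmonic (K x y : R) :
  (forall m : nat, x <= y + K / m.+1%:R) -> x <= y.
Proof.
move=> xK; apply/ler_addgt0Pr => e e0; have [m /ltW Km] := harmonic_small K e0.
by apply: le_trans (xK m) _; rewrite lerD2l.
Qed.

(* A modulus [r] that only gets small along a subsequence suffices, because
   [r m] controls all indices beyond [m]. *)
Lemma cauchy_lim (K : numFieldType) (V : completeNormedModType K)
    (f : nat -> V) (r : nat -> K) :
  (forall e, 0 < e -> exists m, r m < e) ->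
  (forall m n, (m <= n)%N -> `|f n - f m| <= r m) ->
  exists l : V, forall e, 0 < e ->
    exists N, forall n, (N <= n)%N -> `|l - f n| < e.
Proof.
move=> r0 fr.
have /cauchy_cvgP fc : cauchy (f @ \oo).
  apply: cauchy_exP => e e0; have [m rm] := r0 _ e0.
  exists (f m), m => // n /= mn; rewrite -ball_normE /= distrC.
  exact: le_lt_trans (fr _ _ mn) rm.
exists (lim (f @ \oo)) => e e0.
have /cvgrPdist_lt /(_ e e0) [N _ NP] := fc.
by exists N => n Nn; apply: NP.
Qed.

Lemma complex_cauchy_lim (f : nat -> R[i]) (r : nat -> R) :
  (forall e, 0 < e -> exists m, r m < e) ->
  (forall m n, (m <= n)%N -> normc (f n - f m) <= r m) ->
  exists l : R[i], forall m, normc (l - f m) <= r m.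
Proof.
move=> r0 fr.
have [|x xP] := @cauchy_lim R R (fun n => complex.Re (f n)) r r0.
  move=> m n mn; rewrite -ReN -ReD.
  exact: le_trans (Re_le_normc _) (fr _ _ mn).
have [|y yP] := @cauchy_lim R R (fun n => complex.Im (f n)) r r0.
  move=> m n mn; rewrite -ImN -ImD.
  exact: le_trans (Im_le_normc _) (fr _ _ mn).
exists (x +i* y) => m; apply/ler_addgt0Pr => e e0.
have e2 : 0 < e / 2 by rewrite divr_gt0.
have [N1 xN] := xP _ e2; have [N2 yN] := yP _ e2.
pose n := maxn m (maxn N1 N2).
have := fr m n (leq_maxl _ _).
have := xN n _; have := yN n _.
rewrite /n !leq_max !leqnn !orbT -/n => /(_ isT) h1 /(_ isT) h2 h3.
have -> : x +i* y - f m = (x +i* y - f n) + (f n - f m) by ring.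
apply: le_trans (normcD _ _) _; rewrite addrC lerD //.
apply: le_trans (normc_le_ReIm _) _; rewrite !(ReD, ImD, ReN, ImN) /=.
by rewrite [leRHS]splitr lerD // ltW.
Qed.

End ComplexModulus.

(** * The norm of a C*-algebra as a real number *)

Section CStarNorm.
Variables (R : realType) (A : cstarAlgType R).
Implicit Types (a b x y : A) (c : R[i]).

Definition nrm a : R := complex.Re `|a|.

Lemma nrmE a : `|a| = (nrm a)%:C.
Proof. by rewrite -ge0_complexE. Qed.

Lemma nrm_ge0 a : 0 <= nrm a.
Proof. by rewrite -ler0c -nrmE normr_ge0. Qed.

Lemma nrmD a b : nrm (a + b) <= nrm a + nrm b.
Proof. by rewrite -lecR rmorphD /= -!nrmE ler_normD. Qed.

Lemma nrmN a : nrm (- a) = nrm a.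
Proof. by rewrite /nrm normrN. Qed.

Lemma nrmB a b : nrm (a - b) = nrm (b - a).
Proof. by rewrite /nrm distrC. Qed.

Lemma nrm_triB a b : nrm (a - b) <= nrm a + nrm b.
Proof. by rewrite -(nrmN b) nrmD. Qed.

Lemma nrmZ c a : nrm (c *: a) = normc c * nrm a.
Proof. by apply: complexI; rewrite rmorphM /= -!nrmE normrZ. Qed.

Lemma nrm0 : nrm 0 = 0.
Proof. by rewrite /nrm normr0. Qed.

Lemma nrm_le0 a : nrm a <= 0 -> a = 0.
Proof. by move=> a0; apply/eqP; rewrite -normr_le0 nrmE lecR. Qed.

Lemma nrmM a b : nrm (a ** b) <= nrm a * nrm b.
Proof. by rewrite -lecR rmorphM /= -!nrmE cstar_normM. Qed.

Lemma nrm_starM a : nrm (star a ** a) = nrm a ^+ 2.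
Proof. by apply: complexI; rewrite rmorphXn /= -!nrmE cstar_norm_starM. Qed.

Lemma nrm_star_le a : nrm a <= nrm (star a).
Proof.
have [a0|a0] := leP (nrm a) 0; first exact: le_trans a0 (nrm_ge0 _).
by have := nrmM (star a) a; rewrite nrm_starM expr2 ler_pM2r.
Qed.

Lemma nrm_star a : nrm (star a) = nrm a.
Proof.
apply/eqP; rewrite eq_le nrm_star_le andbT.
by rewrite -[in leRHS](starK a) nrm_star_le.
Qed.

Lemma starZc c a : star (c *: a) = conjc c *: star a.
Proof. exact: starZ. Qed.

Lemma star0 : star 0 = 0 :> A.
Proof. by have := starZc 0 (0 : A); rewrite conjc0 !scale0r. Qed.

Lemma starN a : star (- a) = - star a.
Proof. by rewrite -scaleN1r starZc rmorphN rmorph1 scaleN1r. Qed.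

Lemma starB a b : star (a - b) = star a - star b.
Proof. by rewrite starD starN. Qed.

Lemma cstar_mul0r a : a ** 0 = 0.
Proof. by have := cstar_mulZr 0 a (0 : A); rewrite !scale0r. Qed.

Lemma cstar_mul0l a : 0 ** a = 0.
Proof. by have := cstar_mulZl 0 (0 : A) a; rewrite !scale0r. Qed.

Lemma cstar_mulNr a b : a ** (- b) = - (a ** b).
Proof. by rewrite -scaleN1r cstar_mulZr scaleN1r. Qed.

Lemma cstar_mulNl a b : (- a) ** b = - (a ** b).
Proof. by rewrite -scaleN1r cstar_mulZl scaleN1r. Qed.

Lemma cstar_cauchy_lim (f : nat -> A) (r : nat -> R) :
  (forall e, 0 < e -> exists m, r m < e) ->
  (forall m n, (m <= n)%N -> nrm (f n - f m) <= r m) ->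
  exists l : A, forall m, nrm (l - f m) <= r m.
Proof.
move=> r0 fr.
have [e| |l lP] := @cauchy_lim R[i] A f (fun m => (r m)%:C).
- rewrite ltcE /= => /andP[/eqP e0 /r0 [m rm]].
  by exists m; rewrite ltcE /= e0 eqxx.
- by move=> m n /fr; rewrite nrmE lecR.
exists l => m; apply/ler_addgt0Pr => e e0.
have [|N NP] := lP e%:C; first by rewrite ltcR.
have := fr m (maxn m N) (leq_maxl _ _).
have := NP (maxn m N) (leq_maxr _ _); rewrite nrmE ltcR => /ltW h1 h2.
set n := maxn m N in h1 h2.
have -> : l - f m = (l - f n) + (f n - f m) by rewrite addrA subrK.
by apply: le_trans (nrmD _ _) _; rewrite addrC lerD.
Qed.

End CStarNorm.

(** * Unitization *)

Definition unitization (R : realType) (A : cstarAlgType R) : Type :=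
  (R[i]^o * A)%type.

Section Unitization.
Variables (R : realType) (A : cstarAlgType R).
Local Notation A1 := (unitization A).

HB.instance Definition _ := GRing.Lmodule.copy A1 (R[i]^o * A)%type.

Definition unitization_mul (X Y : A1) : A1 :=
  (X.1 * Y.1, X.1 *: Y.2 + Y.1 *: X.2 + X.2 ** Y.2).
Definition unitization_one : A1 := (1, 0).

Fact unitization_mulA : associative unitization_mul.
Proof.
move=> [x a] [y b] [z c]; rewrite /unitization_mul /= mulrA; congr pair.
rewrite !(scalerDr, cstar_mulDl, cstar_mulDr, cstar_mulZl, cstar_mulZr).
rewrite !scalerA cstar_mulA (mulrC (y : R[i])) !(mulrC (z : R[i])).
rewrite -!addrA; do 2 congr (_ + _); rewrite addrCA; congr (_ + _).
by rewrite [RHS]addrCA; congr (_ + _); rewrite addrCA.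
Qed.
Fact unitization_mul1l : left_id unitization_one unitization_mul.
Proof.
by move=> [x a];
  rewrite /unitization_mul /= mul1r scale1r scaler0 cstar_mul0l !addr0.
Qed.
Fact unitization_mul1r : right_id unitization_one unitization_mul.
Proof.
by move=> [x a];
  rewrite /unitization_mul /= mulr1 scale1r scaler0 cstar_mul0r addr0 add0r.
Qed.
Fact unitization_mulDl : left_distributive unitization_mul +%R.
Proof.
move=> [x a] [y b] [z c]; rewrite /unitization_mul /=; congr pair => /=.
  by rewrite mulrDl.
rewrite /= scalerDl scalerDr cstar_mulDl [RHS]addrACA; congr (_ + _).
by rewrite addrACA.
Qed.
Fact unitization_mulDr : right_distributive unitization_mul +%R.
Proof.
move=> [x a] [y b] [z c]; rewrite /unitization_mul /=; congr pair => /=.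
  by rewrite mulrDr.
rewrite /= scalerDl scalerDr cstar_mulDr [RHS]addrACA; congr (_ + _).
by rewrite addrACA.
Qed.
Fact unitization_one_neq0 : unitization_one != 0.
Proof. by apply/eqP => -[] /eqP; rewrite oner_eq0. Qed.
HB.instance Definition _ := GRing.Zmodule_isNzRing.Build A1
  unitization_mulA unitization_mul1l unitization_mul1r
  unitization_mulDl unitization_mulDr unitization_one_neq0.

Fact unitization_scaleAl (c : R[i]) (X Y : A1) : c *: (X * Y) = (c *: X) * Y.
Proof.
case: X Y => [x a] [y b]; congr pair => /=; first exact: mulrA.
by rewrite !scalerDr !scalerA cstar_mulZl (mulrC (y : R[i])).
Qed.
HB.instance Definition _ := GRing.Lmodule_isLalgebra.Build R[i] A1
  unitization_scaleAl.
Fact unitization_scaleAr (c : R[i]) (X Y : A1) : c *: (X * Y) = X * (c *: Y).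
Proof.
case: X Y => [x a] [y b]; congr pair => /=; first exact: mulrCA.
by rewrite !scalerDr !scalerA cstar_mulZr (mulrC (x : R[i])).
Qed.
HB.instance Definition _ := GRing.Lalgebra_isAlgebra.Build R[i] A1
  unitization_scaleAr.

Definition ustar (X : A1) : A1 := (conjc X.1, star X.2).
Definition emb (a : A) : A1 := (0, a).
(** [A] is an ideal of the unitization, so left multiplication by [X] maps it to itself. *)
Definition act (X : A1) (b : A) : A := X.1 *: b + X.2 ** b.

Lemma act_emb X b : emb (act X b) = X * emb b.
Proof. by rewrite /act /emb; congr pair => /=;
  rewrite ?mulr0 // scale0r addr0. Qed.

Lemma embM a b : emb (a ** b) = emb a * emb b.
Proof. by congr pair => /=; rewrite ?mulr0 // !scale0r !add0r. Qed.
Lemma embD a b : emb (a + b) = emb a + emb b.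
Proof. by congr pair => /=; rewrite ?addr0. Qed.
Lemma embN a : emb (- a) = - emb a.
Proof. by congr pair => /=; rewrite ?oppr0. Qed.
Lemma embB a b : emb (a - b) = emb a - emb b.
Proof. by rewrite embD embN. Qed.
Lemma embZ c a : emb (c *: a) = c *: emb a.
Proof. by congr pair => /=; rewrite ?scaler0. Qed.
Lemma emb_inj : injective emb.
Proof. by move=> a b []. Qed.
Lemma emb_star a : emb (star a) = ustar (emb a).
Proof. by congr pair => /=; rewrite oppr0. Qed.
Lemma embP (X : A1) : X.1 = 0 -> X = emb X.2.
Proof. by case: X => x a /= ->. Qed.

Lemma ustarK : involutive ustar.
Proof. by case=> x a; rewrite /ustar /= conjcK starK. Qed.
Lemma ustarD X Y : ustar (X + Y) = ustar X + ustar Y.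
Proof. by congr pair => /=; rewrite ?rmorphD ?starD. Qed.
Lemma ustarN X : ustar (- X) = - ustar X.
Proof. by congr pair => /=; rewrite ?rmorphN ?starN. Qed.
Lemma ustarB X Y : ustar (X - Y) = ustar X - ustar Y.
Proof. by rewrite ustarD ustarN. Qed.
Lemma ustarM X Y : ustar (X * Y) = ustar Y * ustar X.
Proof.
congr pair => /=; first by rewrite rmorphM mulrC.
by rewrite !starD !starZc starM [in RHS](addrC (_ *: _)).
Qed.
Lemma ustar1 : ustar 1 = 1.
Proof. by congr pair => /=; rewrite ?oppr0 ?star0. Qed.
Lemma ustarZ c X : ustar (c *: X) = conjc c *: ustar X.
Proof. by congr pair => /=; rewrite ?starZc //; apply: rmorphM. Qed.
Lemma ustarX X n : ustar (X ^+ n) = ustar X ^+ n.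
Proof. by elim: n => [|n IH]; rewrite ?ustar1 // exprS ustarM IH exprSr. Qed.
Lemma ustar0 : ustar 0 = 0.
Proof. by congr pair => /=; rewrite ?oppr0 ?star0. Qed.
Lemma ustar_sum (I : Type) (s : seq I) (P : pred I) (F : I -> A1) :
  ustar (\sum_(i <- s | P i) F i) = \sum_(i <- s | P i) ustar (F i).
Proof. exact: (big_morph ustar ustarD ustar0). Qed.

Lemma actM X Y b : act (X * Y) b = act X (act Y b).
Proof. by apply: emb_inj; rewrite !act_emb mulrA. Qed.
Lemma actD X Y b : act (X + Y) b = act X b + act Y b.
Proof. by apply: emb_inj; rewrite embD !act_emb mulrDl. Qed.
Lemma actZ c X b : act (c *: X) b = c *: act X b.
Proof. by apply: emb_inj; rewrite embZ !act_emb scalerAl. Qed.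
Lemma actBr X a b : act X (a - b) = act X a - act X b.
Proof. by apply: emb_inj; rewrite embB !act_emb embB mulrBr. Qed.
Lemma act1 b : act 1 b = b.
Proof. by apply: emb_inj; rewrite act_emb mul1r. Qed.
Lemma actemb a b : act (emb a) b = a ** b.
Proof. by rewrite /act scale0r add0r. Qed.
Lemma star_act X a b : star (act X a) ** b = star a ** act (ustar X) b.
Proof.
by apply: emb_inj; rewrite !(embM, emb_star, act_emb, ustarM) mulrA.
Qed.

(* Both the operator norm of left multiplication and the modulus of the scalar
   part are C*-seminorms; only together do they separate points when [A]
   already has a unit. *)
Definition bnd (X : A1) (r : R) : Prop :=
  normc X.1 <= r /\ forall b, nrm (act X b) <= r * nrm b.

Lemma bnd_ge0 X r : bnd X r -> 0 <= r.
Proof. by case=> + _; apply: le_trans; apply: normc_ge0. Qed.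

Lemma bnd_le X r s : bnd X r -> r <= s -> bnd X s.
Proof.
move=> [h1 h2] rs; split; first exact: le_trans rs.
by move=> b; apply: le_trans (h2 b) _; rewrite ler_wpM2r ?nrm_ge0.
Qed.

Lemma bnd1 : bnd 1 1.
Proof. by split=> [|b]; rewrite ?normc1 ?act1 ?mul1r. Qed.

Lemma bndD X Y r s : bnd X r -> bnd Y s -> bnd (X + Y) (r + s).
Proof.
move=> [h1 h2] [h3 h4]; split; first exact: le_trans (normcD _ _) (lerD h1 h3).
move=> b; rewrite actD mulrDl.
exact: le_trans (nrmD _ _) (lerD (h2 b) (h4 b)).
Qed.

Lemma bndZ c X r : bnd X r -> bnd (c *: X) (normc c * r).
Proof.
move=> [h1 h2]; split=> [|b]; first by rewrite normcM ler_wpM2l ?normc_ge0.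
by rewrite actZ nrmZ -mulrA ler_wpM2l ?normc_ge0.
Qed.

Lemma bndN X r : bnd X r -> bnd (- X) r.
Proof. by move/(bndZ (-1)); rewrite scaleN1r normcN normc1 mul1r. Qed.

Lemma bndB X Y r s : bnd X r -> bnd Y s -> bnd (X - Y) (r + s).
Proof. by move=> hX /bndN; apply: bndD. Qed.

Lemma bndM X Y r s : bnd X r -> bnd Y s -> bnd (X * Y) (r * s).
Proof.
move=> hX [h3 h4]; have r0 := bnd_ge0 hX; case: hX => h1 h2.
split=> [|b]; first by rewrite normcM ler_pM ?normc_ge0.
rewrite actM -mulrA; apply: le_trans (h2 _) _.
exact: ler_wpM2l.
Qed.

Lemma bnd0 : bnd 0 0.
Proof. by move: (bndZ 0 bnd1); rewrite scale0r normc0 mul0r. Qed.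

Lemma bndX X r n : bnd X r -> bnd (X ^+ n) (r ^+ n).
Proof.
by move=> hX; elim: n => [|n IH]; rewrite ?expr0 ?exprS;
  [exact: bnd1|exact: bndM].
Qed.

Lemma bnd_sum n (F : nat -> A1) (r : nat -> R) :
  (forall i, bnd (F i) (r i)) -> bnd (\sum_(i < n) F i) (\sum_(i < n) r i).
Proof.
move=> h; elim: n => [|n IH]; first by rewrite !big_ord0; apply: bnd0.
by rewrite !big_ord_recr; apply: bndD.
Qed.

Lemma bnd_emb a r : bnd (emb a) r <-> nrm a <= r.
Proof.
split=> [h|h].
  have r0 := bnd_ge0 h; case: h => _ /(_ (star a)); rewrite actemb.
  rewrite -{1}(starK a) nrm_starM nrm_star.
  have [a0|a0] := leP (nrm a) 0; first by move=> _; apply: le_trans a0 r0.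
  by rewrite expr2 ler_pM2r.
split=> [|b]; first by rewrite [_.1]/(0 : R[i]) normc0; apply: le_trans h;
  apply: nrm_ge0.
rewrite actemb; apply: le_trans (nrmM _ _) _.
by rewrite ler_wpM2r ?nrm_ge0.
Qed.

Lemma nrm_act X r b : bnd X r -> nrm (act X b) <= r * nrm b.
Proof. by case. Qed.

(** With [y = X* b], the C*-identity gives [|y|^2 = |b* X y| <= |b| r |y|], and [|y|] cancels. *)
Lemma bnd_ustar X r : bnd X r -> bnd (ustar X) r.
Proof.
move=> hX; have r0 := bnd_ge0 hX; case: hX => h1 h2.
split=> [|b]; first by rewrite normc_conj.
have [/nrm_le0 -> |y0] := leP (nrm (act (ustar X) b)) 0.
  by rewrite nrm0 mulr_ge0 ?nrm_ge0.
rewrite -(ler_pM2r y0) -expr2 -nrm_starM.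
rewrite star_act ustarK; apply: le_trans (nrmM _ _) _; rewrite nrm_star.
by rewrite (mulrC r) -mulrA ler_wpM2l ?nrm_ge0.
Qed.

(** The C*-identity of [A] passes to left multiplications: [|X b|^2 = |b* X* X b| <= r^2 |b|^2]. *)
Lemma bnd_cstar X r : 0 <= r -> bnd (ustar X * X) (r ^+ 2) -> bnd X r.
Proof.
move=> r0 [h1 h2]; split=> [|b].
  rewrite -(ler_pXn2r (n := 2)) ?nnegrE ?normc_ge0 //.
  by move: h1; rewrite normcM normc_conj.
rewrite -(ler_pXn2r (n := 2)) ?nnegrE ?mulr_ge0 ?nrm_ge0 //.
rewrite -nrm_starM star_act -actM exprMn.
apply: le_trans (nrmM _ _) _; rewrite nrm_star.
have := h2 b; set t := nrm (act _ _); have := nrm_ge0 b; set u := nrm b.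
move=> u0 tu; apply: le_trans (ler_wpM2l u0 tu) _.
by rewrite mulrCA expr2.
Qed.

End Unitization.

(** * Square roots *)

Section SquareRoot.
Variables (R : realType) (A : cstarAlgType R).
Local Notation A1 := (unitization A).
Implicit Types (X Y C : A1).

Lemma bnd_exists X : exists2 r, 0 <= r & bnd X r.
Proof.
have h : bnd X (normc X.1 * 1 + nrm X.2).
  rewrite [X in bnd X](_ : _ = X.1 *: 1 + emb X.2).
    by apply: bndD; [apply/bndZ/bnd1 | apply/bnd_emb].
  case: X => c a; congr pair => /=; first by rewrite addr0 [RHS]mulr1.
  by rewrite scaler0 add0r.
by exists (normc X.1 * 1 + nrm X.2) => //; apply: bnd_ge0 h.
Qed.

Lemma bnd_harmonic0 X K : (forall n : nat, bnd X (K / n.+1%:R)) -> X = 0.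
Proof.
move=> h; have X1 : X.1 = 0.
  apply/eq0_normc/eqP; rewrite eq_le normc_ge0 andbT.
  by apply: (@le_harmonic _ K) => n; rewrite add0r; case: (h n).
rewrite (embP X1) in h *; congr emb; apply: nrm_le0.
by apply: (@le_harmonic _ K) => n; rewrite add0r; apply/bnd_emb.
Qed.

Lemma bnd_lim X (F : nat -> A1) K r :
  (forall n, bnd (F n) r) -> (forall n, bnd (X - F n) (K / n.+1%:R)) -> bnd X r.
Proof.
move=> hF hX.
have h n : bnd X (r + K / n.+1%:R).
  by rewrite -(subrK (F n) X) addrC; apply: bndD.
split=> [|b]; apply: le_harmonic => n.
  by case: (h n) => h1 _; apply: h1.
have [_ /(_ b)] := h n; rewrite mulrDl (mulrAC K) => h2.
exact: h2.
Qed.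

Variable C : A1.

(** Iteration for [D = (C + D^2) / 2], which is equivalent to [(1 - D)^2 = 1 - C]. *)
Fixpoint sqrt_iter (n : nat) : A1 :=
  if n is m.+1 then 2^-1 *: (C + sqrt_iter m ^+ 2) else 0.

(** The same iteration for the scalar [1] in place of [C]: it increases to [1] and majorizes the
    norms. *)
Fixpoint sqrt_maj (n : nat) : R :=
  if n is m.+1 then (1 + sqrt_maj m ^+ 2) / 2 else 0.

Lemma sqrt_maj_itv n : 0 <= sqrt_maj n <= 1.
Proof.
elim: n => [|n] /=; first by rewrite lexx ler01.
set t := sqrt_maj n => /andP[t0 t1]; nra.
Qed.

Lemma sqrt_maj_rate n : 1 - sqrt_maj n <= 2 / n.+1%:R.
Proof.
elim: n => [|n]; first by rewrite subr0 divr1; lra.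
have := sqrt_maj_itv n => /=; set t := sqrt_maj n => /andP[t0 t1].
rewrite !ler_pdivlMr ?ltr0n // -[n.+2%:R]natr1 -[n.+1%:R]natr1.
have := ler0n R n; set k : R := n%:R => k0 h.
(* For [n > 0] the bound [2 / (n + 1)] is at most [1], a range where [l - l ^+ 2 / 2] is increasing
   in the error [l]. *)
have [n0|n0] := eqVneq n 0%N; last first.
  have k1 : 1 <= k by rewrite ler1n lt0n.
  pose l := 1 - t; have l0 : 0 <= l by rewrite subr_ge0.
  have l1 : l <= 1 by rewrite gerBl.
  have -> : 1 - (1 + t ^+ 2) / 2 = l - l ^+ 2 / 2 by rewrite /l; field.
  have hl : l * (k + 1) <= 2 by [].
  clearbody l.
  pose q := 2 / (k + 1).
  have lq : l <= q by rewrite /q ler_pdivlMr //; lra.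
  have q1 : q <= 1 by rewrite /q ler_pdivrMr; lra.
  have : l - l ^+ 2 / 2 <= q - q ^+ 2 / 2 by nra.
  have -> : q - q ^+ 2 / 2 = 2 * k / (k + 1) ^+ 2.
    by rewrite /q; field; apply: lt0r_neq0; lra.
  move=> h2; apply: (@le_trans _ _ (2 * k / (k + 1) ^+ 2 * (k + 1 + 1))).
    by rewrite ler_wpM2r //; lra.
  rewrite mulrAC ler_pdivrMr; last by rewrite exprn_gt0 //; lra.
  nra.
have k00 : k = 0 by rewrite /k n0.
by rewrite k00; nra.
Qed.

Lemma sqrt_iter_comm Y : Y * C = C * Y ->
  forall n, Y * sqrt_iter n = sqrt_iter n * Y.
Proof.
move=> YC; elim=> [|n IH] /=; first by rewrite mulr0 mul0r.
rewrite -scalerAr -scalerAl mulrDr mulrDl YC; congr (_ *: (_ + _)).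
by rewrite !expr2 mulrA IH -!mulrA IH.
Qed.

Lemma sqrt_iter_commC n : C * sqrt_iter n = sqrt_iter n * C.
Proof. exact: sqrt_iter_comm. Qed.

Lemma sqrt_iter_comm_iter m n :
  sqrt_iter m * sqrt_iter n = sqrt_iter n * sqrt_iter m.
Proof. by rewrite (sqrt_iter_comm (esym (sqrt_iter_commC m))). Qed.

Lemma sqrt_iter_star n : ustar C = C -> ustar (sqrt_iter n) = sqrt_iter n.
Proof.
move=> sC; elim: n => [|n IH] /=; first exact: ustar0.
rewrite ustarZ ustarD ustarX sC IH; congr (_ *: _).
by rewrite conjc_inv conjc_nat.
Qed.

(** An idempotent [C.1] factors out of every step of the iteration, leaving the scalar majorant. *)
Lemma sqrt_iter_scalar n : C.1 * C.1 = C.1 ->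
  (sqrt_iter n).1 = C.1 * (sqrt_maj n)%:C.
Proof.
move=> CC; elim: n => [|n IH]; first by rewrite mulr0.
rewrite [LHS](_ : _ = 2^-1 * (C.1 + (sqrt_iter n).1 * (sqrt_iter n).1)) //.
rewrite IH mulrACA CC /= rmorphM rmorphD rmorphM rmorph1 fmorphV rmorph_nat.
by ring.
Qed.

Hypothesis bC : bnd C 1.

Lemma normc_half : normc (2^-1 : R[i]) = 2^-1.
Proof.
rewrite normcV; congr (_^-1); have := normc_real (2 : R).
by rewrite ger0_norm // => <-; rewrite rmorph_nat.
Qed.

Lemma bnd_sqrt_iter n : bnd (sqrt_iter n) (sqrt_maj n).
Proof.
elim: n => [|n IH] /=; first exact: bnd0.
by rewrite mulrC -[X in X * _]normc_half; apply/bndZ/bndD => //; apply: bndX.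
Qed.

(** Since the iterates commute, an increment is half the previous increment times a sum of two
    iterates. The majorant factors alike, so the bounds carry over by induction. *)
Lemma bnd_sqrt_iterS n :
  bnd (sqrt_iter n.+1 - sqrt_iter n) (sqrt_maj n.+1 - sqrt_maj n).
Proof.
elim: n => [|n IH].
  by rewrite !subr0; apply: (bnd_sqrt_iter 1).
rewrite [X in bnd X](_ : _ = 2^-1 *: ((sqrt_iter n.+1 - sqrt_iter n) *
     (sqrt_iter n.+1 + sqrt_iter n))).
  rewrite [X in bnd _ X](_ : _ = 2^-1 * ((sqrt_maj n.+1 - sqrt_maj n) *
     (sqrt_maj n.+1 + sqrt_maj n))); last by rewrite /=; field.
  rewrite -normc_half; apply/bndZ/bndM => //.
  by apply: bndD; apply: bnd_sqrt_iter.
rewrite mulrBl !mulrDr (sqrt_iter_comm_iter n n.+1) opprD addrA addrK -!expr2.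
by rewrite -[LHS]scalerBr opprD addrACA subrr add0r.
Qed.

Lemma bnd_sqrt_iterD m n : (m <= n)%N ->
  bnd (sqrt_iter n - sqrt_iter m) (sqrt_maj n - sqrt_maj m).
Proof.
move=> /subnK <-; elim: (n - m)%N => [|k IH].
  by rewrite add0n !subrr; apply: bnd0.
rewrite addSn -(subrK (sqrt_iter (k + m)) (sqrt_iter _.+1)).
rewrite -(subrK (sqrt_maj (k + m)) (sqrt_maj _.+1)) -!(addrA (_ - _)).
by apply: bndD IH; apply: bnd_sqrt_iterS.
Qed.

(* The constant term of [C] has to be idempotent only because [R[i]] is not
   known to be complete to the library: it makes the constant terms of the
   iterates converge to an explicit limit. *)
Lemma sqrt_one_sub : C.1 * C.1 = C.1 -> exists D : A1,
  [/\ bnd D 1, (1 - D) ^+ 2 = 1 - C, D.1 = C.1, ustar C = C -> ustar D = D &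
      forall Y, Y * C = C * Y -> Y * D = D * Y].
Proof.
move=> CC.
have nC : normc C.1 <= 1 by case: bC.
(* Subtracting the scalar part leaves the component in [A], at the price of doubling the bound. *)
have bS m n : (m <= n)%N ->
    bnd (emb (sqrt_iter n).2 - emb (sqrt_iter m).2)
        (2 * (sqrt_maj n - sqrt_maj m)).
  move=> mn; rewrite [X in bnd X](_ : _ = (sqrt_iter n - sqrt_iter m) -
      (C.1 * (sqrt_maj n - sqrt_maj m)%:C) *: 1).
    rewrite mulr2n mulrDl !mul1r; apply: bndB; first exact: bnd_sqrt_iterD.
    have d0 := bnd_ge0 (bnd_sqrt_iterD mn).
    apply: bnd_le (bndZ _ (@bnd1 _ _)) _; rewrite mulr1 normcM normc_real.
    by rewrite ger0_norm // ler_piMl.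
  rewrite rmorphB mulrBr -!sqrt_iter_scalar //.
  congr pair => /=; first by rewrite [X in _ = _ - X]mulr1 !subrr.
  by rewrite scaler0 subr0.
have [|m n mn|z zP] := @cstar_cauchy_lim R A (fun n => (sqrt_iter n).2)
    (fun n => 4 / n.+1%:R); first exact: harmonic_small.
  apply/bnd_emb; rewrite embB; apply: bnd_le (bS _ _ mn) _.
  have := sqrt_maj_rate m; have := sqrt_maj_itv n => /andP[_].
  have -> : 4 / m.+1%:R = 2 * (2 / m.+1%:R) :> R by rewrite mulrA -natrM.
  by move=> h1 h2; rewrite ler_pM2l ?ltr0n //; apply: le_trans h2;
    rewrite lerD2r.
pose D : A1 := (C.1, z).
have DP n : bnd (D - sqrt_iter n) (6 / n.+1%:R).
  rewrite [X in bnd X](_ : _ = (C.1 * (1 - sqrt_maj n)%:C) *: 1 +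
      emb (z - (sqrt_iter n).2)).
    have -> : 6 / n.+1%:R = 2 / n.+1%:R + 4 / n.+1%:R :> R.
      by rewrite -mulrDl -natrD.
    apply: bndD; last exact/bnd_emb.
    apply: bnd_le (bndZ _ (@bnd1 _ _)) _; rewrite mulr1 normcM normc_real.
    apply: le_trans (sqrt_maj_rate n); have /andP[_ d1] := sqrt_maj_itv n.
    by rewrite ger0_norm ?subr_ge0 // ler_piMl // subr_ge0.
  rewrite rmorphB mulrBr rmorph1 mulr1 -sqrt_iter_scalar //.
  by congr pair => /=; rewrite ?addr0 ?scaler0 ?add0r //; rewrite [RHS]mulr1.
have bi n : bnd (sqrt_iter n) 1.
  by apply: bnd_le (bnd_sqrt_iter n) _; case/andP: (sqrt_maj_itv n).
have bD : bnd D 1 := bnd_lim bi DP.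
exists D; split=> // [|sC|Y YC].
- suff h : C + D ^+ 2 - (D + D) = 0.
    rewrite -sqrrN opprB sqrrB1 addrC; congr (1 + _); apply/eqP.
    by rewrite -addr_eq0 addrC addrA mulr2n h.
  (* By the recursion, [C + D^2 - 2 D] splits into two products with [D - D_n] and twice
     [D - D_(n+1)], each of size at most [6 / (n + 1)]. *)
  apply: (@bnd_harmonic0 _ 24) => n.
  rewrite [X in bnd X](_ : _ = D * (D - sqrt_iter n) +
     (D - sqrt_iter n) * sqrt_iter n -
     ((D - sqrt_iter n.+1) + (D - sqrt_iter n.+1))).
    have -> : 24 / n.+1%:R =
        6 / n.+1%:R + 6 / n.+1%:R + (6 / n.+1%:R + 6 / n.+1%:R) :> R.
      by rewrite -!mulrDl -!natrD.
    have b' : bnd (D - sqrt_iter n.+1) (6 / n.+1%:R).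
      apply: bnd_le (DP _) _;
        rewrite ler_pM2l ?ltr0n // lef_pV2 ?posrE ?ltr0n //.
      by rewrite ler_nat.
    apply: bndB; last exact: bndD.
    apply: bndD; rewrite -[6 / _]mul1r; first exact: bndM.
    by rewrite mulrC; apply: bndM.
  have ss : sqrt_iter n.+1 + sqrt_iter n.+1 = C + sqrt_iter n ^+ 2.
    rewrite /= -scalerDl [X in X *: _](_ : _ = 1) ?scale1r //.
    by rewrite -mulr2n -(mulr_natl (2^-1)) divff // pnatr_eq0.
  rewrite mulrBr mulrBl addrA subrK -!expr2.
  rewrite [in RHS]addrACA -opprD ss opprB addrA; congr (_ - _).
  by rewrite addrACA addNr addr0 addrC.
- apply/eqP; rewrite -subr_eq0; apply/eqP; apply: (@bnd_harmonic0 _ 12) => n.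
  rewrite [X in bnd X](_ : _ = ustar (D - sqrt_iter n) - (D - sqrt_iter n)).
    have -> : 12 / n.+1%:R = 6 / n.+1%:R + 6 / n.+1%:R :> R.
      by rewrite -mulrDl -natrD.
    by apply: bndB => //; apply: bnd_ustar.
  by rewrite ustarB sqrt_iter_star // opprB addrA subrK.
- have [r r0 bY] := bnd_exists Y.
  apply/eqP; rewrite -subr_eq0; apply/eqP.
  apply: (@bnd_harmonic0 _ (r * 6 + 6 * r)) => n.
  rewrite [X in bnd X](_ : _ = Y * (D - sqrt_iter n) - (D - sqrt_iter n) * Y).
    by rewrite [(_ + _) / _]mulrDl -[r * 6 / _]mulrA [6 * r / _]mulrAC;
      apply: bndB; apply: bndM.
  by rewrite mulrBr mulrBl sqrt_iter_comm // opprB addrA subrK.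
Qed.

End SquareRoot.

(** * Square roots inside the algebra *)

Section Squares.
Variables (R : realType) (A : cstarAlgType R).
Local Notation A1 := (unitization A).
Implicit Types (x y a : A).

(** The condition [|1 - x| <= 1] stands in for positivity. As [1 - x] has constant term [1], so has
    [D], and the root [1 - D] lies in [A]. The root satisfies the same condition, so roots can be
    iterated. *)
Lemma cstar_sqrt x : star x = x -> bnd (1 - emb x) 1 ->
  exists y, [/\ star y = y, bnd (1 - emb y) 1, y ** y = x &
    forall Y : A1, Y * emb x = emb x * Y -> Y * emb y = emb y * Y].
Proof.
move=> sx bx; have [|D [bD DD D1 sD cD]] := sqrt_one_sub bx.
  by rewrite /= subr0 mulr1.
have e1 : (1 - D).1 = 0 by rewrite /= D1 /= subr0 subrr.
have eD := embP e1; exists (1 - D).2; split.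
- apply: emb_inj; rewrite emb_star -eD ustarB ustar1 sD //.
  by rewrite ustarB ustar1 -emb_star sx.
- by rewrite -eD subKr.
- by apply: emb_inj; rewrite embM -eD -expr2 DD subKr.
- move=> Y Yx; rewrite -eD mulrBr mulrBl mulr1 mul1r; congr (_ - _).
  by apply: cD; rewrite mulrBr mulrBl mulr1 mul1r Yx.
Qed.

(* With [k = sqrt (1 - x^2)], the element [u = x + i k] is unitary, so that
   [k = (u - star u) / 2i] has norm at most [1], and so does [k^2]. *)
Lemma bnd_one_sub_sqr x : star x = x -> nrm x <= 1 -> bnd (1 - emb (x ** x)) 1.
Proof.
move=> sx /bnd_emb bx.
have bxx : bnd (emb (x ** x)) 1 by rewrite embM -[1]mulr1; apply: bndM.
have [|D [bD DD D1 sD cD]] := sqrt_one_sub bxx; first by rewrite mulr0.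
pose X := emb x; pose k := 1 - D.
have sX : ustar X = X by rewrite -emb_star sx.
have sk : ustar k = k.
  by rewrite ustarB ustar1 sD // embM ustarM sX.
have Xk : X * k = k * X.
  rewrite mulrBr mulrBl mulr1 mul1r; congr (_ - _).
  by apply: cD; rewrite embM mulrA.
have kk : k * k = 1 - X * X by rewrite -expr2 DD embM.
pose U := X + 'i *: k.
have sU : ustar U = X - 'i *: k.
  rewrite ustarD ustarZ sX sk -scaleNr; congr (_ + _ *: _).
  by apply/eqP; rewrite eq_complex /= oppr0 !eqxx.
have UU : ustar U * U = 1.
  rewrite sU mulrBl !mulrDr -!scalerAl -!scalerAr scalerA.
  rewrite Xk kk -[_ * 'i]expr2 sqr_i scaleN1r opprD opprK addrA addrK.
  by rewrite addrC subrK.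
have bU : bnd U 1.
  by apply: bnd_cstar; rewrite ?ler01 // expr1n UU; apply: bnd1.
have bk : bnd k 1.
  rewrite [k](_ : _ = (- 'i / 2) *: (U - ustar U)).
    rewrite [X in bnd _ X](_ : _ = normc (- 'i / 2 : R[i]) * (1 + 1)).
      by apply/bndZ/bndB => //; apply: bnd_ustar.
    rewrite normcM normc_half normcN [normc 'i](_ : _ = 1) ?mul1r.
      by rewrite mulVf // pnatr_eq0.
    by rewrite /= expr0n expr1n add0r sqrtr1.
  rewrite sU /U opprB addrC addrA subrK -scalerDl scalerA.
  rewrite [X in X *: _](_ : _ = 1) ?scale1r //.
  rewrite -mulr2n -(mulr_natr 'i) mulrA mulrAC divfK ?pnatr_eq0 //.
  by rewrite mulNr -expr2 sqr_i opprK.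
by rewrite embM -kk -[1]mulr1; apply: bndM.
Qed.

End Squares.

(** * The sesquilinear form of a positive functional *)

Section Functional.
Variables (R : realType) (A : cstarAlgType R) (v : {scalar A}).
Hypothesis hv : positive_functional v.
Implicit Types (x y a b : A).

Definition qf (f : A -> R[i]) a : R := complex.Re (f (star a ** a)).

Lemma qfE a : v (star a ** a) = (qf v a)%:C.
Proof. by rewrite -ge0_complexE //; apply: hv. Qed.

Lemma qf_ge0 a : 0 <= qf v a.
Proof. by rewrite -ler0c -qfE; apply: hv. Qed.

Lemma form_expand x y (c : R[i]) :
  v (star (x + c *: y) ** (x + c *: y)) =
  v (star x ** x) + c * v (star x ** y) + conjc c * v (star y ** x) +
  conjc c * c * v (star y ** y).
Proof.
rewrite starD starZc !(cstar_mulDl, cstar_mulDr, cstar_mulZl, cstar_mulZr).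
rewrite !(linearD, linearZ) /= -!mulrA !addrA.
by congr (_ + _); rewrite addrAC.
Qed.

(** Polarization: the values at [x + y] and [x + i y] have imaginary part zero, which gives the two
    real equations. *)
Lemma form_herm x y : v (star x ** y) = conjc (v (star y ** x)).
Proof.
have := qfE (x + 'i *: y); have := qfE (x + 1 *: y).
rewrite !form_expand !qfE; case: (v _) => a b; case: (v _) => c d.
move=> /(congr1 (@complex.Im R)) /= h1 /(congr1 (@complex.Im R)) /= h2.
by apply/eqP; rewrite eq_complex /=; apply/andP; split; apply/eqP; lra.
Qed.

Lemma form_CS x y : normc (v (star y ** x)) ^+ 2 <= qf v y * qf v x.
Proof.
set z := v _; set n := normc z ^+ 2.
(* Positivity at [x - t z y]: the factor [z] turns the cross term into [|z|^2]. *)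
have h t : 0 <= qf v x - 2 * t * n + t ^+ 2 * n * qf v y.
  have := qf_ge0 (x + (- t%:C * z) *: y); rewrite {1}/qf form_expand.
  rewrite (form_herm x y) -/z !qfE /n normc_sqr; case: (z) => a b /=.
  by congr (0 <= _); ring.
have n0 : 0 <= n by rewrite sqr_ge0.
by apply: quad_discr; rewrite ?sqr_ge0 ?qf_ge0.
Qed.

End Functional.

(** * Positive functionals on squares *)

Section Cone.
Variables (R : realType) (A : cstarAlgType R).
Local Notation A1 := (unitization A).
Implicit Types (x y a : A) (r s t : R).

(** For self-adjoint [x] this says that the spectrum lies between [0] and [2 r]: positivity as a
    norm bound, stable under sums and limits. *)
Definition cone r x : Prop := bnd (r%:C *: 1 - emb x) r.

Lemma coneD r s x y : cone r x -> cone s y -> cone (r + s) (x + y).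
Proof.
move=> hx hy; rewrite /cone rmorphD embD scalerDl opprD addrACA.
exact: bndD.
Qed.

Lemma coneZ t r x : 0 <= t -> cone r x -> cone (t * r) (t%:C *: x).
Proof.
move=> t0 hx; rewrite /cone embZ rmorphM -scalerA -scalerBr.
by rewrite -[X in X * r]ger0_norm // -normc_real; apply: bndZ.
Qed.

Lemma cone_le r s x : r <= s -> cone r x -> cone s x.
Proof.
move=> rs hx; rewrite /cone -(subrK r s) rmorphD scalerDl -addrA.
apply: bndD hx;
  rewrite -[X in bnd _ X]mulr1 -[X in X * 1]ger0_norm ?subr_ge0 //.
by rewrite -normc_real; apply/bndZ/bnd1.
Qed.

Lemma half_exp_le n : (2^-1 : R) ^+ n <= n.+1%:R^-1.
Proof.
rewrite exprVn lef_pV2 ?posrE ?ltr0n ?exprn_gt0 //.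
by rewrite -natrX ler_nat ltn_expl.
Qed.

Lemma nrm_lim_star (F : nat -> A) x (r : nat -> R) :
  (forall e, 0 < e -> exists m, r m < e) ->
  (forall n, star (F n) = F n) -> (forall n, nrm (x - F n) <= r n) ->
  star x = x.
Proof.
move=> r0 sF xF; apply/eqP; rewrite -subr_eq0; apply/eqP/nrm_le0.
apply/ler_addgt0Pr => e e0; rewrite add0r.
have [m /ltW rm] := r0 _ (divr_gt0 e0 (ltr0Sn _ 1)).
rewrite (_ : _ - _ = star (x - F m) - (x - F m)); last first.
  by rewrite starB sF opprB addrA subrK.
apply: le_trans (nrm_triB _ _) _; rewrite nrm_star [e]splitr.
by apply: lerD; apply: le_trans (xF m) rm.
Qed.

(* Were the functional unbounded on squares, a rapidly convergent series of
   squares would have a sum on which it is infinite; tails of the series are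
   squares because [cone 1] is closed. *)
Lemma positive_bounded_on_squares (v : {scalar A}) (hv : positive_functional v)
    :
  exists M : R, forall x, star x = x -> nrm x <= 1 -> qf v x <= M.
Proof.
apply: contrapT => /forallNP noM.
have ex (n : nat) : exists x, [/\ star x = x, nrm x <= 1 & 2 ^+ n.+1 < qf v x].
  apply: contrapT => /forallNP nox; apply: (noM (2 ^+ n.+1)) => x sx x1.
  by rewrite leNgt; apply/negP => h; apply: (nox x).
have [x xP] := choice ex.
pose h : R := 2^-1.
have h0 n : 0 <= h ^+ n by rewrite exprn_ge0 // invr_ge0.
(* The weights match the choice of [x i]: the series converges in norm, while each term adds at
   least [1] to [v]. *)
pose X n := \sum_(i < n) (h ^+ i.+1)%:C *: (x i ** x i).
have XS n : X n.+1 = X n + (h ^+ n.+1)%:C *: (x n ** x n).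
  by rewrite /X big_ord_recr.
have sX n : star (X n) = X n.
  elim: n => [|n IH]; first by rewrite /X big_ord0 star0.
  rewrite XS starD IH starZc starM; case: (xP n) => -> _ _.
  by rewrite conjc_real.
have hS n : h ^+ n = h ^+ n.+1 + h ^+ n.+1 by rewrite exprS /h; field.
(* [h ^+ m - h ^+ (k + m)] is the sum of the weights of the terms from [m] to [k + m - 1]. *)
have Xc m k : cone (h ^+ m - h ^+ (k + m)) (X (k + m)%N - X m) /\
              nrm (X (k + m)%N - X m) <= h ^+ m - h ^+ (k + m).
  elim: k => [|k [IH1 IH2]].
    rewrite add0n !subrr nrm0 lexx; split=> //.
    by rewrite /cone scale0r sub0r; apply/bndN/bnd_emb; rewrite nrm0.
  have -> : h ^+ m - h ^+ (k.+1 + m) = (h ^+ m - h ^+ (k + m)) + h ^+ (k +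
    m).+1.
    by rewrite addSn (hS (k + m)%N); ring.
  rewrite addSn XS [X _ + _ - _]addrAC; case: (xP (k + m)%N) => sx x1 _; split.
    apply: coneD => //; rewrite -[X in cone X]mulr1; apply: coneZ => //.
    by rewrite /cone scale1r; apply: bnd_one_sub_sqr.
  apply: le_trans (nrmD _ _) _; apply: lerD => //.
  rewrite nrmZ normc_real ger0_norm // ler_piMr //.
  by rewrite -{1}sx nrm_starM -[leRHS](expr1n _ 2) ler_pXn2r ?nnegrE ?nrm_ge0.
have hsmall : forall e : R, 0 < e -> exists m, h ^+ m < e.
  move=> e /(harmonic_small 1) [m hm]; exists m; apply: le_lt_trans hm.
  by rewrite mul1r half_exp_le.
have [|L LP] := @cstar_cauchy_lim R A X (fun n => h ^+ n) hsmall.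
  move=> m n /subnK <-; have [_] := Xc m (n - m)%N; move/le_trans; apply.
  by rewrite gerBl.
have sL : star L = L := nrm_lim_star hsmall sX LP.
have Lc m : cone 1 (L - X m).
  apply: (@bnd_lim _ _ _ (fun k => 1%:C *: 1 - emb (X (k + m)%N - X m)) 1) => k.
    have [Xk _] := Xc m k; apply: cone_le Xk; rewrite lerBlDr.
    apply: (@le_trans _ _ 1); last by rewrite lerDl.
    by rewrite /h exprn_ile1 ?invr_ge0 ?invf_le1 ?ler1n.
  rewrite [Y in bnd Y](_ : _ = emb (X (k + m)%N - L)).
    apply/bnd_emb; rewrite nrmB; apply: le_trans (LP _) _.
    apply: le_trans (half_exp_le _) _.
    rewrite mul1r lef_pV2 ?posrE ?ltr0n // ler_nat ltnS; exact: leq_addr.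
  by rewrite opprB addrC addrA subrK -embB opprB addrA subrK.
(* [L - X m] has a self-adjoint square root, so [v] is nonnegative on it. *)
have Lge m : complex.Re (v (X m)) <= complex.Re (v L).
  have [| |y [sy _ yy _]] := cstar_sqrt (x := L - X m).
  - by rewrite starB sL sX.
  - by have hc := Lc m; rewrite /cone scale1r in hc; exact: hc.
  rewrite -subr_ge0 -ReN -ReD -linearN -linearD /= -yy -{1}sy; apply: qf_ge0.
  exact: hv.
have Xge m : m%:R <= complex.Re (v (X m)).
  elim: m => [|m IH]; first by rewrite /X big_ord0 linear0.
  rewrite XS linearD linearZ /= ReD -natr1; apply: lerD => //.
  case: (xP m) => sx _ xm; have := xm.
  rewrite -{2}sx qfE // -rmorphM /= => {}xm.
  apply: le_trans (ler_wpM2l (h0 m.+1) (ltW xm)).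
  by rewrite -exprMn /h mulVf ?expr1n // pnatr_eq0.
pose K := complex.Re (v L).
have := Num.Theory.archi_boundP (normr_ge0 K); rewrite ltNge.
move/negP; apply; apply: le_trans (ler_norm _).
exact: le_trans (Xge _) (Lge _).
Qed.

End Cone.

(** * Factorization *)

Section Cesaro.
Variables (R : realType) (A : cstarAlgType R).
Local Notation A1 := (unitization A).
Implicit Types (X Y D : A1).

Definition cesaro (F : nat -> A1) (n : nat) : A1 :=
  n.+1%:R^-1 *: \sum_(k < n.+1) F k.

Lemma cesaro_comm Y F n : (forall k, GRing.comm Y (F k)) ->
  GRing.comm Y (cesaro F n).
Proof.
move=> YF; rewrite /GRing.comm -scalerAr -scalerAl; congr (_ *: _).
by apply: commr_sum => k _; apply: YF.
Qed.

Lemma cesaro_star F n : (forall k, ustar (F k) = F k) ->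
  ustar (cesaro F n) = cesaro F n.
Proof.
move=> sF; rewrite ustarZ ustar_sum conjc_inv conjc_nat; congr (_ *: _).
by apply: eq_bigr => k _.
Qed.

Lemma normc_inv_nat n : normc (n.+1%:R^-1 : R[i]) = n.+1%:R^-1.
Proof.
rewrite normcV; congr (_^-1); have := normc_real (n.+1%:R : R).
by rewrite ger0_norm ?ler0n // => <-; rewrite rmorph_nat.
Qed.

Lemma bnd_cesaro F n r : (forall k, bnd (F k) r) -> bnd (cesaro F n) r.
Proof.
move=> bF; have := bnd_sum n.+1 bF; rewrite sumr_const card_ord => h.
apply: bnd_le (bndZ _ h) _; rewrite normc_inv_nat -[r *+ _]mulr_natl mulKf //.
by rewrite pnatr_eq0.
Qed.

Variable D : A1.
Hypothesis bD : bnd D 1.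

Let S k := \sum_(j < k) D ^+ j.
(** For [G = 1 - D], these averages are asymptotically killed by [G], while [inv_avg] inverts [G] up
    to them. *)
Definition power_avg n := cesaro (fun k => D ^+ k) n.
Definition inv_avg n := cesaro S n.

Lemma bnd_powers k : bnd (D ^+ k) 1.
Proof. by rewrite -(expr1n _ k); apply: bndX. Qed.

Lemma bnd_power_avg n : bnd (power_avg n) 1.
Proof. exact/bnd_cesaro/bnd_powers. Qed.

Lemma mul_one_sub_sum k : (1 - D) * S k = 1 - D ^+ k.
Proof. by rewrite -opprB mulNr -subrX1 opprB. Qed.

(** Multiplication by [1 - D] telescopes the sum of powers to [1 - D ^+ n.+1], of size at most
    [2]. *)
Lemma bnd_mul_power_avg n : bnd ((1 - D) * power_avg n) (2 / n.+1%:R).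
Proof.
rewrite -scalerAr mul_one_sub_sum mulrC -normc_inv_nat.
by apply/bndZ; rewrite [2]mulr2n; apply: bndB (bnd_powers _); apply: bnd1.
Qed.

Lemma mul_inv_avg n : (1 - D) * inv_avg n = 1 - power_avg n.
Proof.
rewrite -scalerAr mulr_sumr; under eq_bigr do rewrite mul_one_sub_sum.
rewrite sumrB sumr_const card_ord scalerBr; congr (_ - _).
by rewrite -[X in _ *: X](scaler_nat n.+1) scalerA mulVf ?scale1r // pnatr_eq0.
Qed.

Lemma power_avg_comm Y n : GRing.comm Y D -> GRing.comm Y (power_avg n).
Proof. by move=> YD; apply: cesaro_comm => k; apply: commrX. Qed.

Lemma inv_avg_comm Y n : GRing.comm Y D -> GRing.comm Y (inv_avg n).
Proof.
by move=> YD; apply: cesaro_comm => k; apply: commr_sum => j _; apply: commrX.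
Qed.

Lemma power_avg_star n : ustar D = D -> ustar (power_avg n) = power_avg n.
Proof. by move=> sD; apply: cesaro_star => k; rewrite ustarX sD. Qed.

Lemma inv_avg_star n : ustar D = D -> ustar (inv_avg n) = inv_avg n.
Proof.
move=> sD; apply: cesaro_star => k; rewrite /S ustar_sum.
by apply: eq_bigr => j _; rewrite ustarX sD.
Qed.

Lemma power_avg_scalar n : D.1 = 1 -> (power_avg n).1 = 1.
Proof.
move=> D1; have e (i : nat) : (D ^+ i).1 = 1.
  elim: i => [|i IH] //.
  have -> : (D ^+ i.+1).1 = (D.1 : R[i]) * (D ^+ i).1 by rewrite exprS.
  by rewrite D1 IH mulr1.
have es m : (\sum_(k < m) D ^+ k).1 = m%:R.
  elim: m => [|m IH]; first by rewrite big_ord0.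
  rewrite big_ord_recr -natr1 -IH; congr (_ + _); exact: e.
rewrite [LHS](_ : _ = n.+1%:R^-1 * (\sum_(k < n.+1) D ^+ k).1) //.
by rewrite es mulVf // pnatr_eq0.
Qed.

End Cesaro.

Section Factorization.
Variables (R : realType) (A : cstarAlgType R).
Local Notation A1 := (unitization A).
Implicit Types (a b : A).

(* If [g ^+ 4 = |a star(a)|], multiplication by [g ^+ 2] bounds the action on
   [a]; the positivity of [a star(a)] itself is never used. *)
Lemma nrm_act_root a (G Z : A1) r :
  let H := emb (a ** star a) in
  H ^+ 2 = G ^+ 8 -> GRing.comm H Z -> GRing.comm G Z -> GRing.comm H G ->
  ustar Z = Z -> bnd (G ^+ 2 * Z) r -> nrm (act Z a) <= r.
Proof.
move=> H HG HZ GZ HGc sZ hT; have r0 := bnd_ge0 hT.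
have sH : ustar H = H by rewrite -emb_star starM starK.
have eX : ustar (ustar (emb (act Z a))) * ustar (emb (act Z a)) = H * Z ^+ 2.
  rewrite ustarK act_emb ustarM sZ -emb_star mulrA -(mulrA Z) -embM -/H.
  by rewrite -HZ -mulrA.
(* The C*-identity is used twice: [|Z a|^2 = |H Z^2|] and [|H Z^2|^2 = |(G^2 Z)^4| <= r^4]. *)
apply/bnd_emb; rewrite -[emb _]ustarK; apply: bnd_ustar; apply: bnd_cstar => //.
rewrite eX; apply: bnd_cstar; first by rewrite exprn_ge0.
have -> : ustar (H * Z ^+ 2) = H * Z ^+ 2.
  by rewrite ustarM ustarX sZ sH; apply/esym/commrX.
rewrite -expr2 exprMn_comm; last exact: commrX.
have -> : H ^+ 2 * Z ^+ 2 ^+ 2 = (G ^+ 2 * Z) ^+ 4.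
  rewrite HG -exprM exprMn_comm -?exprM //.
  by apply/commr_sym/commrX/commr_sym.
by rewrite -exprM; apply: bndX.
Qed.

(* [g] is an eighth root of [(a ** star a)^2], [b] the limit of [R_n a] with
   [R_n] the Cesaro means of the partial sums of the geometric series for
   [g^-1]. *)
Lemma factorization a : nrm a <= 1 -> exists b, forall n : nat,
  exists e w : A, [/\ star e = e, nrm e <= 2, star w = w,
    nrm w <= 2 / n.+1%:R & a = e ** a + w ** b].
Proof.
move=> a1; pose h := a ** star a.
have sh : star h = h by rewrite starM starK.
have h1 : nrm h <= 1.
  by apply: le_trans (nrmM _ _) _; rewrite nrm_star mulr_ile1 ?nrm_ge0.
have shh : star (h ** h) = h ** h by rewrite starM sh.
(* Three successive roots: [g1^2 = h^2], [g2^2 = g1], [g^2 = g2]. *)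
have [g1 [sg1 bg1 g1E cg1]] := cstar_sqrt shh (bnd_one_sub_sqr sh h1).
have [g2 [sg2 bg2 g2E cg2]] := cstar_sqrt sg1 bg1.
have [g [sg bg gE cg]] := cstar_sqrt sg2 bg2.
pose D : A1 := 1 - emb g; pose G := emb g.
have GE : G = 1 - D by rewrite subKr.
have sD : ustar D = D by rewrite ustarB ustar1 -emb_star sg.
have D1 : D.1 = 1 by rewrite /= subr0.
have HG8 : emb h ^+ 2 = G ^+ 8.
  rewrite (exprM G 2 4) [G ^+ 2]expr2 -embM gE (exprM (emb g2) 2 2).
  by rewrite [emb g2 ^+ 2]expr2 -embM g2E !expr2 -!embM g1E.
have CH : GRing.comm (emb h) G.
  by apply/cg/cg2/cg1; rewrite -!embM cstar_mulA.
have CHD : GRing.comm (emb h) D by apply: commrB => //; apply: commr1.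
have CGD : GRing.comm G D by apply: commrB => //; apply: commr1.
have bG : bnd G 2.
  by rewrite GE [2]mulr2n; apply: bndB => //; apply: bnd1.
have key Z r : GRing.comm (emb h) Z -> GRing.comm G Z -> ustar Z = Z ->
    bnd (G ^+ 2 * Z) r -> nrm (act Z a) <= r.
  by move=> hZ gZ sZ; apply: nrm_act_root HG8 hZ gZ CH sZ.
have avg n : nrm (act (power_avg D n) a) <= 4 / n.+1%:R.
  apply: key; first exact: power_avg_comm.
  - exact: power_avg_comm.
  - exact: power_avg_star.
  have -> : 4 / n.+1%:R = 2 * (2 / n.+1%:R) :> R by rewrite mulrA -natrM.
  rewrite expr2 -mulrA.
  by apply: bndM => //; rewrite GE; apply: bnd_mul_power_avg.
have inv m n : (m <= n)%N ->
    nrm (act (inv_avg D n) a - act (inv_avg D m) a) <= 4 / m.+1%:R.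
  move=> mn; have -> : act (inv_avg D n) a - act (inv_avg D m) a =
      act (inv_avg D n - inv_avg D m) a.
    by apply: emb_inj; rewrite embB !act_emb mulrBl.
  apply: key; try by apply: commrB; apply: inv_avg_comm.
    by rewrite ustarB !inv_avg_star.
  (* One factor [G] turns the difference of approximate inverses into one of power averages; the
     other makes these small. *)
  have GR : G * (inv_avg D n - inv_avg D m) = power_avg D m - power_avg D n.
    by rewrite mulrBr GE !mul_inv_avg opprB addrC addrA subrK.
  rewrite expr2 -mulrA GR mulrBr [X in bnd _ X](_ : _ = 2 / m.+1%:R + 2 /
    m.+1%:R); last first.
    by rewrite -mulrDl -natrD.
  apply: bndB; first by rewrite GE; apply: bnd_mul_power_avg.
  rewrite GE; apply: bnd_le (bnd_mul_power_avg bg n) _.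
  by rewrite ler_pM2l ?ltr0n // lef_pV2 ?posrE ?ltr0n // ler_nat.
have [|b bP] := @cstar_cauchy_lim R A (fun n => act (inv_avg D n) a)
    (fun n => 4 / n.+1%:R) _ inv; first exact: harmonic_small.
(* [G] sends [act (inv_avg D n) a] to [a - act (power_avg D n) a], which tends to [a]. *)
have ab : act G b = a.
  apply/eqP; rewrite -subr_eq0; apply/eqP/nrm_le0.
  apply: (@le_harmonic _ 12) => n; rewrite add0r.
  rewrite (_ : _ - a = act G (b - act (inv_avg D n) a) - act (power_avg D n) a).
    apply: le_trans (nrm_triB _ _) _.
    rewrite [leRHS](_ : _ = 2 * (4 / n.+1%:R) + 4 / n.+1%:R); last first.
      by rewrite mulrA -natrM -mulrDl -natrD.
    apply: lerD => //; apply: le_trans (nrm_act _ bG) _.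
    by rewrite ler_wpM2l.
  rewrite actBr -actM GE mul_inv_avg -GE.
  rewrite -[RHS]addrA -opprD; congr (_ - _); rewrite -actD subrK.
  by rewrite act1.
(* Split [a] by [1 = E + power_avg D n]; as [a = G b], the second part is [w b] with
   [w = act (power_avg D n) g]. The constant term of [E] vanishes, so [E] lies in [A]. *)
exists b => n; pose E := 1 - power_avg D n.
have E1 : E.1 = 0 by rewrite [LHS](_ : _ = 1 - (power_avg D n).1) //
  power_avg_scalar // subrr.
have sE : ustar E = E by rewrite ustarB ustar1 power_avg_star.
exists E.2, (act (power_avg D n) g); split.
- by apply: emb_inj; rewrite emb_star -embP // sE.
- apply/bnd_emb; rewrite -embP // [2]mulr2n.
  by apply: bndB; [apply: bnd1 | apply: bnd_power_avg].
- apply: emb_inj;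
  rewrite emb_star act_emb ustarM -emb_star sg power_avg_star //.
  exact: power_avg_comm.
- apply/bnd_emb; rewrite act_emb.
  have <- : GRing.comm G (power_avg D n) by apply: power_avg_comm.
  by rewrite -/G GE; apply: bnd_mul_power_avg.
- apply: emb_inj; rewrite embD !embM -embP // act_emb -mulrA.
  by rewrite -/G -(act_emb G) ab mulrBl mul1r subrK.
Qed.

End Factorization.

(** * Bounding a positive functional by its form *)

Section PositiveFunctional.
Variables (R : realType) (A : cstarAlgType R) (v : {scalar A}).
Hypothesis hv : positive_functional v.
Implicit Types (a b e x y : A).

Lemma qfZ (t : R) a : qf v (t%:C *: a) = t ^+ 2 * qf v a.
Proof.
rewrite /qf starZc conjc_real cstar_mulZl cstar_mulZr !linearZ /= qfE //=.
by ring.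
Qed.

Lemma qf0 : qf v 0 = 0.
Proof. by rewrite /qf cstar_mul0r linear0. Qed.

(** Scaled to [|b| = 1], the element [1 - b* b] of the unitization is the square of a self-adjoint
    [K], and positivity at [K e] is the claim. *)
Lemma qf_mul_le b e : qf v (b ** e) <= nrm b ^+ 2 * qf v e.
Proof.
wlog b1 : b / nrm b = 1.
  move=> wl; have [b0|b0] := leP (nrm b) 0.
    by rewrite (nrm_le0 b0) cstar_mul0l qf0 mulr_ge0 ?sqr_ge0 ?qf_ge0.
  have nb : nrm ((nrm b)^-1%:C *: b) = 1.
    rewrite nrmZ normc_real ger0_norm ?invr_ge0 ?ltW //.
    by rewrite mulVf // gt_eqF.
  have := wl ((nrm b)^-1%:C *: b); rewrite nb => /(_ erefl).
  rewrite cstar_mulZl qfZ expr1n mul1r exprVn ler_pdivrMl ?exprn_gt0 //.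
have [| |D [bD DD D1 sD _]] := @sqrt_one_sub _ _ (emb (star b ** b)).
- by apply/bnd_emb; rewrite nrm_starM b1 expr1n.
- by rewrite mulr0.
have {}sD : ustar (1 - D) = 1 - D.
  by rewrite ustarB ustar1 sD // -emb_star starM starK.
have := qf_ge0 hv (act (1 - D) e); rewrite /qf star_act sD -actM -expr2 DD.
rewrite (_ : act _ _ = e - (star b ** b) ** e).
  rewrite cstar_mulDr cstar_mulNr linearB /= ReD ReN subr_ge0.
  by rewrite b1 expr1n mul1r starM !cstar_mulA.
by apply: emb_inj; rewrite act_emb mulrBl mul1r embB !embM.
Qed.

Lemma positive_sqr_bound :
  exists2 C : R, 0 <= C & forall a, normc (v a) ^+ 2 <= C * qf v a.
Proof.
have [M0 M0P] := positive_bounded_on_squares hv.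
pose M := `|M0|; have M_ge0 : 0 <= M by rewrite normr_ge0.
have MP x r : star x = x -> nrm x <= r -> qf v x <= M * r ^+ 2.
  move=> sx xr; have r0 := le_trans (nrm_ge0 x) xr.
  have [x0|x0] := leP (nrm x) 0.
    by rewrite (nrm_le0 x0) qf0 mulr_ge0 ?sqr_ge0.
  have rp : 0 < r by apply: lt_le_trans xr.
  have := M0P (r^-1%:C *: x); rewrite starZc conjc_real sx nrmZ normc_real.
  rewrite ger0_norm ?invr_ge0 // ler_pdivrMl // mulr1 => /(_ erefl xr).
  rewrite qfZ exprVn ler_pdivrMl ?exprn_gt0 // mulrC => h.
  by apply: le_trans h _; rewrite ler_wpM2r ?sqr_ge0 // ler_norm.
(* [4 M] bounds [qf v] on self-adjoint elements of norm at most [2]; the other factor [2] comes from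
   squaring a sum of two terms. *)
exists (8 * M) => [|a]; first by rewrite mulr_ge0.
wlog a1 : a / nrm a <= 1.
  move=> wl; have n0 : 0 < nrm a + 1 by rewrite ltr_wpDl ?nrm_ge0.
  have := wl ((nrm a + 1)^-1%:C *: a); rewrite nrmZ normc_real.
  rewrite ger0_norm ?invr_ge0 ?(ltW n0) // ler_pdivrMl // mulr1 lerDl ler01.
  rewrite linearZ /= normcM normc_real qfZ exprMn => /(_ isT).
  rewrite ger0_norm ?invr_ge0 ?(ltW n0) // [leRHS]mulrCA ler_pM2l //.
  by rewrite exprn_gt0 // invr_gt0.
have [b bP] := factorization a1.
apply: (@le_harmonic _ (8 * M * qf v b)) => n.
have [e [w [se e2 sw wn ae]]] := bP n.
have ea : normc (v (e ** a)) ^+ 2 <= 4 * M * qf v a.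
  rewrite -{1}se; apply: le_trans (form_CS hv a e) _.
  by rewrite ler_wpM2r ?qf_ge0 // (le_trans (MP _ _ se e2)) // mulrC -natrX.
have wb : normc (v (w ** b)) ^+ 2 <= 4 * M * qf v b / n.+1%:R.
  rewrite -{1}sw; apply: le_trans (form_CS hv b w) _.
  rewrite (mulrAC _ (qf v b)) ler_wpM2r ?qf_ge0 //.
  apply: le_trans (MP _ _ sw wn) _; rewrite mulrC -(mulrA 4) (mulrC M) mulrA.
  rewrite ler_wpM2r // exprMn -natrX ler_wpM2l // exprVn.
  rewrite lef_pV2 ?posrE ?exprn_gt0 ?ltr0n // -natrX ler_nat.
  by rewrite expnS expn1 leq_pmulr.
rewrite {1}ae linearD /=.
apply: le_trans (lerXn2r 2 _ _ (normcD _ _)) _;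
  rewrite ?nnegrE ?addr_ge0 ?normc_ge0 //.
have -> : 8 * M * qf v b / n.+1%:R = 2 * (4 * M * qf v b / n.+1%:R) by ring.
have -> : 8 * M * qf v a = 2 * (4 * M * qf v a) by ring.
exact: sqrD_le.
Qed.

End PositiveFunctional.

(** * Riesz representation and the derived functional *)

Section Riesz.
Variables (R : realType) (A : cstarAlgType R) (s v : {scalar A}).
Hypothesis hs : positive_functional s.
Implicit Types (a b e x y : A).

Lemma qf_expand (t : R) x y :
  qf s (x + t%:C *: y) =
  qf s x + 2 * t * complex.Re (s (star x ** y)) + t ^+ 2 * qf s y.
Proof.
rewrite {1}/qf form_expand (form_herm hs y x) !(qfE hs).
by case: (s (star x ** y)) => c d /=; ring.
Qed.

Lemma qfD x y :
  qf s (x + y) = qf s x + 2 * complex.Re (s (star x ** y)) + qf s y.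
Proof. by have := qf_expand 1 x y; rewrite scale1r expr1n mulr1 mul1r. Qed.

Lemma qfB x y :
  qf s (x - y) = qf s x - 2 * complex.Re (s (star x ** y)) + qf s y.
Proof.
have := qf_expand (-1) x y; rewrite rmorphN scaleN1r => ->; ring.
Qed.

Lemma qfD_le x y : qf s (x + y) <= 2 * qf s x + 2 * qf s y.
Proof.
by have := qf_ge0 hs (x - y); rewrite qfB qfD; lra.
Qed.

Variable C : R.
Hypothesis hC : forall a, normc (v a) ^+ 2 <= C * qf s a.

(** If [xi] represents [v] in the completion for [s], this is [|a - xi|^2 - |xi|^2], so minimizing
    it approximates [xi]. *)
Let J a := qf s a - 2 * complex.Re (v a).

Lemma riesz_lower_bound a : - `|C| <= J a.
Proof.
have := Re_le_normc (v a); have := hC a; have := qf_ge0 hs a; rewrite /J.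
set q := qf s a; set z := complex.Re _ => q0 h1 h2.
have zz : z ^+ 2 <= `|C| * q.
  apply: (@le_trans _ _ (C * q)); last by rewrite ler_wpM2r // ler_norm.
  by apply: le_trans h1;
    rewrite -real_normK ?num_real // lerXn2r ?nnegrE ?normc_ge0.
clearbody z q; have := normr_ge0 C; move: zz; set c := `|C| => zz c0.
(* If [J a < - c], then [2 z > q + c], against [4 z^2 <= 4 c q <= (q + c)^2]. *)
rewrite leNgt; apply/negP => h.
have : 0 < (2 * z - (q + c)) * (2 * z + (q + c)) by apply: mulr_gt0; lra.
by have := sqr_ge0 (q - c); nra.
Qed.

Lemma riesz_sequence : exists e : nat -> A,
  (forall m n, (m <= n)%N -> qf s (e n - e m) <= 4 / m.+1%:R) /\
  (forall n y, normc (s (star (e n) ** y) - v y) ^+ 2 <= qf s y / n.+1%:R).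
Proof.
have hinf : has_inf (range J).
  split; first by exists (J 0), 0.
  by exists (- `|C|) => _ [a _ <-]; apply: riesz_lower_bound.
pose j := inf (range J).
have jJ a : j <= J a by apply: ge_inf; [case: hinf | exists a].
have ex (n : nat) : exists a, J a < j + n.+1%:R^-1.
  have [|_ [a _ <-] aP] := @inf_adherent _ (range J) n.+1%:R^-1 _ hinf.
    by rewrite invr_gt0.
  by exists a.
have [e eP] := choice ex; exists e; split=> [m n mn|n y].
  (* Parallelogram identity: [J] at the midpoint is at least [j], whereas at [e n] and [e m] it is
     almost [j]. *)
  have := jJ (2^-1%:C *: (e n + e m)); have := eP n; have := eP m.
  have : n.+1%:R^-1 <= m.+1%:R^-1 :> R.
    by rewrite lef_pV2 ?posrE ?ltr0n // ler_nat.
  have vE : complex.Re (v (2^-1%:C *: (e n + e m))) =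
      2^-1 * (complex.Re (v (e n)) + complex.Re (v (e m))).
    by rewrite linearZ linearD /=; case: (v _) => ? ?; case: (v _) => ? ? /=;
      ring.
  rewrite /J (qfZ hs) vE qfD qfB.
  set hm := m.+1%:R^-1; set hn := n.+1%:R^-1.
  by set a := qf s (e n); set b := qf s (e m);
    set c := complex.Re _ => h1 h2 h3 h4; lra.
(* [e n] is varied by [- t conjc z] times [y]; near minimality then bounds [z] through the
   discriminant. *)
set z := _ - _; set n1 := n.+1%:R^-1.
apply: quad_discr; rewrite ?sqr_ge0 ?qf_ge0 ?invr_ge0 // => t.
have := jJ (e n + (- t%:C * conjc z) *: y); have := eP n; rewrite /J -/n1.
rewrite {2}/qf form_expand // (form_herm hs y) !(qfE hs).
have -> : v (e n + (- t%:C * conjc z) *: y) =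
    v (e n) + (- t%:C * conjc z) * v y by rewrite linearD linearZ.
rewrite normc_sqr.
have : z = s (star (e n) ** y) - v y by [].
case: z => z1 z2; case: (s _) => a b; case: (v y) => c d [-> ->].
case: (v (e n)) => f g /=.
by nra.
Qed.

End Riesz.

(** * Limits from harmonic rates *)

Section Convergence.
Variable R : realType.

Lemma sqr_harmonic_small (K e : R) : 0 < e ->
  exists N, forall n, (N <= n)%N -> forall t, t ^+ 2 <= K / n.+1%:R -> `|t| < e.
Proof.
move=> e0; have [N NK] := harmonic_small `|K| (exprn_gt0 2 e0).
exists N => n Nn t tK; rewrite -(ltr_pXn2r (n := 2)) ?nnegrE ?(ltW e0) //.
rewrite real_normK ?num_real //; apply: le_lt_trans tK _; apply: le_lt_trans NK.
apply: (@le_trans _ _ (`|K| / n.+1%:R));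
  first by rewrite ler_wpM2r ?invr_ge0 ?ler0n // ler_norm.
by rewrite ler_wpM2l // lef_pV2 ?posrE ?ltr0n // ler_nat.
Qed.

Lemma sqr_harmonic_cvg (f : nat -> R) l K :
  (forall n, (f n - l) ^+ 2 <= K / n.+1%:R) -> f @ \oo --> l.
Proof.
move=> h; apply/cvgrPdist_lt => e e0; have [N NP] := sqr_harmonic_small K e0.
by exists N => // n /= Nn; rewrite distrC; apply: NP (h n).
Qed.

Lemma normc_harmonic_Re_cvg (f : nat -> R[i]) l K :
  (forall n, normc (f n - l) ^+ 2 <= K / n.+1%:R) ->
  (fun n => complex.Re (f n)) @ \oo --> complex.Re l.
Proof.
move=> h; apply: (@sqr_harmonic_cvg _ _ K) => n; apply: le_trans (h n).
by rewrite normc_sqr ReD ReN lerDl sqr_ge0.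
Qed.

Lemma normc_harmonic_Im_cvg (f : nat -> R[i]) l K :
  (forall n, normc (f n - l) ^+ 2 <= K / n.+1%:R) ->
  (fun n => complex.Im (f n)) @ \oo --> complex.Im l.
Proof.
move=> h; apply: (@sqr_harmonic_cvg _ _ K) => n; apply: le_trans (h n).
by rewrite normc_sqr ImD ImN lerDr sqr_ge0.
Qed.

Lemma real_cvg_unique (f : nat -> R) (l l' : R) :
  f @ \oo --> l -> f @ \oo --> l' -> l = l'.
Proof.
by move=> h h';
  rewrite -(cvg_lim (@Rhausdorff R) h) -(cvg_lim (@Rhausdorff R) h').
Qed.

Lemma cvg_ge0 (f : nat -> R) (l : R) : f @ \oo --> l -> (forall n, 0 <= f n) ->
    0 <= l.
Proof.
move=> fl f0; rewrite -(cvg_lim _ fl) //; apply: limr_ge.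
  by apply/cvg_ex; exists l.
by apply: nearW.
Qed.

Lemma complex_cvg0P (T : Type) (F : set_system T) (FF : Filter F) (f : T ->
    R[i]) :
  (forall e : R, 0 < e -> \forall x \near F, normc (f x) < e) <->
  f @ F --> (0 : R[i]^o).
Proof.
have P := @cvgrPdist_lt R[i] R[i]^o T F FF f 0.
split=> [h|/P h].
  apply/P => e; rewrite ltcE /= => /andP[/eqP e1 e0].
  apply: filterS (h _ e0) => x fx; rewrite sub0r normrN ltcE /= e1 eqxx.
  exact: fx.
move=> e e0; have := h e%:C; rewrite ltcR => /(_ e0); apply: filterS => x.
by rewrite sub0r normrN ltcR.
Qed.

End Convergence.

(** * The functional of the squared contraction *)

Section Derived.
Variables (R : realType) (A : cstarAlgType R) (s v : {scalar A}).
Hypotheses (hs : positive_functional s) (hv : positive_functional v).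
Hypothesis vs : functional_le v s.
Implicit Types (a b x y : A).

Lemma qf_le a : qf v a <= qf s a.
Proof. by have := vs a; rewrite !qfE // lecR. Qed.

Lemma scalar_of_fun (u : A -> R[i]) : 
  (forall a b, u (a + b) = u a + u b) -> (forall c a, u (c *: a) = c * u a) ->
  exists U : {scalar A}, forall a, U a = u a.
Proof.
move=> uD uZ.
have lu : scalar u by move=> c a b; rewrite uD uZ.
pose U : {scalar A} := HB.pack u (GRing.isLinear.Build R[i] A R[i]^o *%R u lu).
by exists U.
Qed.

(* With [T] the positive contraction representing [v] in the space of [s], and
   [e n] approximating the vector representing the functional [v], [u] is
   [a |-> <T^2 a, xi>] for the cyclic vector [xi]. *)
Lemma derived_functional : exists (e : nat -> A) (u : {scalar A}) (E : R),
  [/\ forall m n, (m <= n)%N -> qf s (e n - e m) <= 4 / m.+1%:R,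
      forall n y, normc (s (star (e n) ** y) - v y) ^+ 2 <= qf s y / n.+1%:R,
      forall n y, normc (v (star (e n) ** y) - u y) ^+ 2 <= 4 * qf v y / n.+1%:R
    & forall n, qf s (e n) <= E].
Proof.
have [C C0 hC] := positive_sqr_bound hv.
have hC' a : normc (v a) ^+ 2 <= C * qf s a.
  by apply: le_trans (hC a) _; rewrite ler_wpM2l // qf_le.
have [e [ec es]] := riesz_sequence hs hC'.
(* Cauchy-Schwarz for [v] together with [v <= s] gives a Cauchy rate, so that [u y] can be defined
   as a limit. *)
have vc y m n : (m <= n)%N ->
    normc (v (star (e n) ** y) - v (star (e m) ** y)) ^+ 2 <=
      4 * qf v y / m.+1%:R.
  move=> mn; rewrite -linearB -cstar_mulNl -cstar_mulDl -starB.
  apply: le_trans (form_CS hv _ _) _.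
  rewrite [leRHS]mulrAC ler_wpM2r ?qf_ge0 //.
  exact: le_trans (qf_le _) (ec _ _ mn).
have ex y : exists l, forall n,
    normc (v (star (e n) ** y) - l) ^+ 2 <= 4 * qf v y / n.+1%:R.
  have q0 n : 0 <= 4 * qf v y / n.+1%:R by rewrite !mulr_ge0 ?invr_ge0 ?qf_ge0.
  have [|m n mn|l lP] := @complex_cauchy_lim R (fun n => v (star (e n) ** y))
      (fun n => Num.sqrt (4 * qf v y / n.+1%:R)).
  - move=> d d0; have [m mP] := harmonic_small (4 * qf v y) (exprn_gt0 2 d0).
    exists m; rewrite -(ltr_pXn2r (n := 2)) ?nnegrE ?sqrtr_ge0 ?(ltW d0) //.
    by rewrite sqr_sqrtr.
  - rewrite -(ler_pXn2r (n := 2)) ?nnegrE ?sqrtr_ge0 ?normc_ge0 //.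
    by rewrite sqr_sqrtr //; apply: vc.
  exists l => n; rewrite normcB -[leRHS]sqr_sqrtr //.
  by rewrite ler_pXn2r ?nnegrE ?sqrtr_ge0 ?normc_ge0.
have [u uP] := choice ex.
(* [K] is arbitrary, so linearity of [u] reduces to exhibiting the expected value as a limit at any
   harmonic rate. *)
have uniq y l K : (forall n, normc (v (star (e n) ** y) - l) ^+ 2 <= K /
  n.+1%:R) ->
    u y = l.
  move=> lP; apply/eqP; rewrite eq_complex; apply/andP; split; apply/eqP.
    exact: real_cvg_unique (normc_harmonic_Re_cvg (uP y))
      (normc_harmonic_Re_cvg lP).
  exact: real_cvg_unique (normc_harmonic_Im_cvg (uP y)) (normc_harmonic_Im_cvg
    lP).
have uD a b : u (a + b) = u a + u b.
  apply: (@uniq _ _ (2 * (4 * qf v a) + 2 * (4 * qf v b))) => n.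
  rewrite cstar_mulDr linearD /= opprD addrACA.
  apply: le_trans (lerXn2r 2 _ _ (normcD _ _)) _;
    rewrite ?nnegrE ?addr_ge0 ?normc_ge0 //.
  rewrite [leRHS]mulrDl -!(mulrA 2); apply: sqrD_le; exact: uP.
have uZ c a : u (c *: a) = c * u a.
  apply: (@uniq _ _ (normc c ^+ 2 * (4 * qf v a))) => n.
  rewrite cstar_mulZr linearZ /= -mulrBr normcM exprMn -[leRHS]mulrA.
  by rewrite ler_wpM2l ?sqr_ge0.
have [U UE] := scalar_of_fun uD uZ.
(* Uniform bound: [e n = e 0 + (e n - e 0)], and the increment has [qf s] at most [4]. *)
exists e, U, (2 * qf s (e 0) + 8); split=> // [n y|n]; first by rewrite UE.
have := qfD_le hs (e 0) (e n - e 0); rewrite addrC subrK.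
by have := ec 0 n (leq0n n); rewrite divr1; lra.
Qed.

End Derived.

(** * Limits along the sequences [a ** e n] *)

Section DerivedLimits.
Variables (R : realType) (A : cstarAlgType R) (s v u : {scalar A}).
Variables (e : nat -> A) (E : R).
Hypotheses (hs : positive_functional s) (hv : positive_functional v).
Hypothesis vs : functional_le v s.
Hypothesis es : forall n y,
  normc (s (star (e n) ** y) - v y) ^+ 2 <= qf s y / n.+1%:R.
Hypothesis eu : forall n y,
  normc (v (star (e n) ** y) - u y) ^+ 2 <= 4 * qf v y / n.+1%:R.
Hypothesis eE : forall n, qf s (e n) <= E.
Variable a : A.

Let c := star a ** a.
(** These sequences represent [T a] and [T c]. *)
Let x n := a ** e n.
Let y n := c ** e n.

Lemma star_square : star c = c.
Proof. by rewrite starM starK. Qed.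

Lemma derived_square n : star (e n) ** y n = star (x n) ** x n.
Proof. by rewrite /y /x starM !cstar_mulA. Qed.

Lemma derived_bound n : qf s (y n) <= nrm c ^+ 2 * E.
Proof.
by apply: le_trans (qf_mul_le hs _ _) _; rewrite ler_wpM2l ?sqr_ge0.
Qed.

Lemma derived_herm n : v (y n) = conjc (v (star (e n) ** c)).
Proof. by rewrite -(form_herm hv) star_square. Qed.

Lemma cvg_v_square : (fun n => complex.Re (v (star (e n) ** c))) @ \oo -->
    complex.Re (u c).
Proof. exact: normc_harmonic_Re_cvg (fun n => eu n c). Qed.

(** By [derived_square] the value is [s (star (e n) ** y n)], close to [v (y n)], the conjugate of
    [v (star (e n) ** c)]. The vector [y n] moves with [n], hence the uniform bound on
    [qf s (y n)]. *)
Lemma derived_rate : exists K, forall n,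
  normc (s (star (x n) ** x n) - conjc (u c)) ^+ 2 <= K / n.+1%:R.
Proof.
exists (2 * (nrm c ^+ 2 * E) + 2 * (4 * qf v c)) => n.
rewrite -derived_square -(subrK (v (y n)) (s _)) -addrA.
apply: le_trans (lerXn2r 2 _ _ (normcD _ _)) _;
  rewrite ?nnegrE ?addr_ge0 ?normc_ge0 //.
rewrite mulrDl -!(mulrA 2); apply: sqrD_le.
  by apply: le_trans (es _ _) _;
    rewrite ler_wpM2r ?invr_ge0 ?ler0n // derived_bound.
by rewrite derived_herm -rmorphB normc_conj.
Qed.

Lemma derived_cvg : (fun n => qf s (x n)) @ \oo --> complex.Re (u c).
Proof.
have [K KP] := derived_rate.
have := normc_harmonic_Re_cvg KP.
by case: (u c).
Qed.

Lemma derived_real : complex.Im (u c) = 0.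
Proof.
have [K KP] := derived_rate.
have := normc_harmonic_Im_cvg KP.
have -> : (fun n => complex.Im (s (star (x n) ** x n))) = fun=> 0.
  by apply/funext => n; rewrite qfE.
move=> h; have := real_cvg_unique (cvg_cst (0 : R)) h.
by case: (u c) => r z /= h0; rewrite -[z]opprK -h0 oppr0.
Qed.

Lemma derived_positive : 0 <= u c.
Proof.
rewrite lecE derived_real eqxx /=.
by apply: cvg_ge0 derived_cvg _ => n; apply: qf_ge0.
Qed.

(** Positivity of [v] at [a - T a], with [qf v (T a) <= qf s (T a) = u c], leaves
    [v c - 2 u c + u c >= 0]. *)
Lemma derived_le : u c <= v c.
Proof.
rewrite lecE derived_real /c qfE // eqxx /= -/c -subr_ge0.
rewrite [X in 0 <= X](_ : _ = qf v a - 2 * complex.Re (u c) + complex.Re (u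
  c)); last first.
  by ring.
apply: (@cvg_ge0 _ (fun n => qf v a - 2 * complex.Re (v (star (e n) ** c)) + qf
  s (x n))).
  apply: cvgD derived_cvg; apply: cvgB; first exact: cvg_cst.
  by apply: cvgMr; apply: cvg_v_square.
move=> n; have := qf_ge0 hv (a - x n);
  rewrite qfB // {2}/x cstar_mulA -/c -/(y n).
rewrite derived_herm; have := qf_le hs hv vs (x n).
by case: (v (star (e n) ** c)) => ? ? /=; lra.
Qed.

(** The squared [s]-length of [T a - r a], expanded with [u] as the form of [T^2] and [v] as the
    form of [T]. *)
Lemma derived_shift_cvg (r : R) :
  (fun n => qf s (x n - r%:C *: a)) @ \oo -->
    complex.Re (u c) - 2 * r * qf v a + r ^+ 2 * qf s a.
Proof.
have -> : (fun n => qf s (x n - r%:C *: a)) = (fun n => qf s (x n) -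
   2 * r * complex.Re (s (star (e n) ** c)) + r ^+ 2 * qf s a).
  apply/funext => n; rewrite -scaleNr -rmorphN qf_expand //.
  by rewrite /x starM -cstar_mulA; ring.
apply: cvgD; last exact: cvg_cst.
apply: cvgB; first exact: derived_cvg.
apply: cvgMr; have := normc_harmonic_Re_cvg (fun n => es n c).
by rewrite /c qfE.
Qed.

Variable t : R.
Hypothesis ut : forall b, u b = t%:C * v b.

(** With [T^2 = t T], the vector [T a - t a] is killed by [T], whose form is [v]. The cubic term
    [qf v (x n)] is, up to a vanishing error, the real part of [u (y n) = t v (y n)]. *)
Lemma derived_shift_cvg0 : (fun n => qf v (x n - t%:C *: a)) @ \oo --> (0 : R).
Proof.
have uc : complex.Re (u c) = t * qf v a.
  by rewrite ut /c qfE //=; ring.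
have d0 : (fun n => qf v (x n) - complex.Re (u (y n))) @ \oo --> (0 : R).
  apply: (@sqr_harmonic_cvg _ _ _ (4 * (nrm c ^+ 2 * E))) => n.
  rewrite subr0; apply: (@le_trans _ _ (4 * qf v (y n) / n.+1%:R)).
    apply: le_trans (eu n (y n)); rewrite derived_square /qf -ReN -ReD.
    by rewrite normc_sqr lerDl sqr_ge0.
  rewrite ler_wpM2r ?invr_ge0 ?ler0n // ler_wpM2l //.
  exact: le_trans (qf_le hs hv vs _) (derived_bound n).
rewrite [X in _ --> X](_ : _ = 0 + (t * complex.Re (u c) - 2 * t * complex.Re
  (u c)
  + t ^+ 2 * qf v a)); last by rewrite uc; ring.
have -> : (fun n => qf v (x n - t%:C *: a)) = (fun n =>
    qf v (x n) - complex.Re (u (y n)) +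
    (t * complex.Re (v (star (e n) ** c)) -
     2 * t * complex.Re (v (star (e n) ** c)) + t ^+ 2 * qf v a)).
  apply/funext => n; rewrite -scaleNr -rmorphN qf_expand // ut derived_herm.
  rewrite {2}/x starM -cstar_mulA -/c.
  by case: (v (star (e n) ** c)) => ? ? /=; ring.
apply: cvgD d0 _; apply: cvgD; last exact: cvg_cst.
by apply: cvgB; apply: cvgMr; apply: cvg_v_square.
Qed.

End DerivedLimits.

(** * Purity, absolute continuity and proportionality *)

Section PureAbsolutelyContinuous.
Variables (R : realType) (A : cstarAlgType R) (v w : {scalar A}).

(** A functional vanishing on squares is positive, hence bounded by its own form, which is zero.
    This reduces equality of functionals to squares. *)
Lemma positive_eq0 (d : {scalar A}) :
  (forall a, d (star a ** a) = 0) -> forall a, d a = 0.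
Proof.
move=> d0 a; have hd : positive_functional d by move=> b; rewrite d0.
have [C _ /(_ a)] := positive_sqr_bound hd; rewrite /qf d0 mulr0 => h.
by apply/eq0_normc/eqP; rewrite -sqrf_eq0 eq_le h sqr_ge0.
Qed.

Lemma absolutely_continuous_scale (alpha : R) :
  (forall a, w a = alpha%:C * v a) -> absolutely_continuous w v.
Proof.
move=> wE f /complex_cvg0P vf _; apply/complex_cvg0P => e e0.
have a1 : 0 < `|alpha| + 1 by rewrite ltr_wpDl.
apply: filterS (vf _ (divr_gt0 e0 a1)) => n; rewrite ltr_pdivlMr // => vn.
rewrite wE normcM normc_real; apply: le_lt_trans vn.
by rewrite mulrC ler_wpM2l ?normc_ge0 // lerDl.
Qed.

Hypotheses (hw : positive_functional w) (hpure : pure_functional v).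

Let s : {scalar A} := v \+ w.

Let hv : positive_functional v. Proof. by case: hpure. Qed.

Let hs : positive_functional s.
Proof. by move=> a; apply: addr_ge0; [apply: hv | apply: hw]. Qed.

Lemma qf_sum a : qf s a = qf v a + qf w a.
Proof. by rewrite /qf -ReD. Qed.

Lemma pure_eq_scale : absolutely_continuous w v ->
  exists2 alpha : R, 0 <= alpha & forall a, w a = alpha%:C * v a.
Proof.
move=> wv.
have vs : functional_le v s.
  by move=> a; rewrite lerDl; apply: hw.
have [e [u [E [ec es eu eE]]]] := derived_functional hs hv vs.
have [_ [a0 va0] pure] := hpure.
have [||t /andP[t0 t1] ut] := pure u.
- by move=> a; apply: derived_positive es eu eE a.
- by move=> a; apply: derived_le es eu eE a.
have uc a : complex.Re (u (star a ** a)) = t * qf v a.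
  by rewrite ut qfE //=; ring.
(* If [t = 0], the limit of [|T a - r a|^2] is [r^2 qf s a - 2 r qf v a]; it is nonnegative for
   arbitrarily small [r > 0], so [v] vanishes on squares. *)
have tp : 0 < t.
  rewrite lt_neqAle t0 andbT; apply: contra va0 => /eqP t00.
  apply/eqP/positive_eq0 => a; rewrite qfE //; congr _%:C.
  apply/eqP; rewrite eq_le qf_ge0 // andbT.
  apply: (@le_harmonic _ (qf s a)) => n; rewrite add0r.
  have := @derived_shift_cvg _ _ _ _ _ _ _ hs hv es eu eE a n.+1%:R^-1.
  rewrite uc -t00 mul0r => /cvg_ge0 /(_ (fun=> qf_ge0 hs _)).
  set r := n.+1%:R^-1; have r0 : 0 < r by rewrite invr_gt0.
  rewrite [X in 0 <= X](_ : _ = r * (qf s a * r - 2 * qf v a)); last by ring.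
  by rewrite pmulr_rge0 //; have := qf_ge0 hv a; lra.
have main a : qf v a = t * qf s a.
  (* [z] represents [T a - t a]: [v] tends to [0] along it and [w] is Cauchy, so absolute continuity
     applies. *)
  pose z n := a ** e n - t%:C *: a.
  have vz := @derived_shift_cvg0 _ _ _ _ _ _ _ hs hv vs eu eE a _ ut.
  have wz : w (star (z n) ** z n) @[n --> \oo] --> (0 : R[i]^o).
    apply: wv.
      apply/complex_cvg0P => d d0; have /cvgrPdist_lt /(_ d d0) := vz.
      apply: filterS => n; rewrite sub0r normrN.
      by rewrite qfE // normc_real.
    apply/complex_cvg0P => d d0.
    have [N NP] := harmonic_small (nrm a ^+ 2 * 4) d0.
    have eN p q : (N <= p)%N -> (N <= q)%N -> qf s (e p - e q) <= 4 / N.+1%:R.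
      have wlg i j : (N <= i)%N -> (i <= j)%N -> qf s (e j - e i) <= 4 /
        N.+1%:R.
        move=> Ni ij; apply: le_trans (ec _ _ ij) _.
        by rewrite ler_pM2l ?ltr0n // lef_pV2 ?posrE ?ltr0n // ler_nat.
      move=> Np Nq; have [pq|/ltnW qp] := leqP p q; last exact: wlg.
      rewrite -opprB -scaleN1r [-1](_ : _ = (-1)%:C); last first.
        by rewrite rmorphN rmorph1.
      by rewrite qfZ // sqrrN expr1n mul1r wlg.
    exists ([set p | (N <= p)%N], [set p | (N <= p)%N]).
      by split; exists N.
    move=> [p q] /= [Np Nq]; apply: le_lt_trans NP.
    rewrite -starB qfE // normc_real ger0_norm ?qf_ge0 //.
    have -> : z p - z q = a ** (e p - e q).
      by rewrite /z opprB addrA subrK cstar_mulDr cstar_mulNr.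
    apply: (@le_trans _ _ (qf s (a ** (e p - e q)))).
      by rewrite qf_sum lerDr qf_ge0.
    apply: le_trans (qf_mul_le hs _ _) _; rewrite -mulrA.
    by rewrite ler_wpM2l ?sqr_ge0 // eN.
  have sz : (fun n => qf s (z n)) @ \oo --> (0 : R).
    rewrite -[0]addr0 (_ : (fun n => _) = fun n => qf v (z n) + qf w (z n)).
      apply: cvgD => //; apply/cvgrPdist_lt => d d0.
      have /complex_cvg0P /(_ d d0) := wz; apply: filterS => n.
      by rewrite sub0r normrN qfE // normc_real.
    by apply/funext => n; rewrite qf_sum.
  (* The limit of [qf s (z n)] is both [0] and [t qf v a - 2 t qf v a + t^2 qf s a]. *)
  have := real_cvg_unique (@derived_shift_cvg _ _ _ _ _ _ _ hs hv es eu eE a t)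
    sz.
  rewrite uc => h; apply/eqP; rewrite -subr_eq0.
  have : t * (qf v a - t * qf s a) = 0 by rewrite -oppr0 -h; ring.
  by move/eqP; rewrite mulf_eq0 gt_eqF.
(* The factor solves [v = t (v + w)] for [w]; [t <= 1] makes it nonnegative. *)
exists ((1 - t) / t); first by rewrite divr_ge0 ?subr_ge0.
(* Equality is known on squares only, so the difference is packed as a functional for
   [positive_eq0]. *)
have [|| d dE] := @scalar_of_fun R A (fun a => (1 - t)%:C * v a - t%:C * w a).
- by move=> a b; rewrite !linearD /= !mulrDr opprD addrACA.
- move=> c a; have -> : v (c *: a) = c * v a by rewrite linearZ.
  have -> : w (c *: a) = c * w a by rewrite linearZ.
  by rewrite mulrBr !(mulrCA c).
have d0 a : d (star a ** a) = 0.
  rewrite dE !qfE // -!rmorphM -rmorphB -[RHS]/(0%:C) /=; congr _%:C.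
  by have := main a; rewrite qf_sum => h; lra.
move=> a; have := positive_eq0 d0 a; rewrite dE => /eqP;
  rewrite subr_eq0 => /eqP h.
have tC : t%:C != 0 by rewrite (fmorph_eq0 (real_complex R)) gt_eqF.
apply: (mulfI tC); rewrite -h [RHS]mulrA -rmorphM; congr (_%:C * _).
by rewrite mulrC divfK // gt_eqF.
Qed.

End PureAbsolutelyContinuous.

Theorem corollary5p7 (R : realType) (A : cstarAlgType R) (v w : {scalar A})
    (hv : positive_functional v) (hw : positive_functional w)
    (hpure : pure_functional v) :
  absolutely_continuous w v <->
  exists2 alpha : R, 0 <= alpha & forall a : A, w a = alpha%:C * v a.
Proof.
split; first exact: pure_eq_scale.
by case=> alpha _; apply: absolutely_continuous_scale.
Qed.
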